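(* Let $(X,\sigma_X)$, $(Y,\sigma_Y)$ be one-sided subshifts and $\pi:X\to Y$ a (one-block) factor map, and suppose $X$ has the specification property. Let $\mathcal F=\{\log f_n\}_{n=1}^\infty$ be an almost additive potential on $X$ with bounded variation, let $\mu\in M(X,\sigma_X)$ be the unique invariant Gibbs measure for $\mathcal F$, and let $\nu=\pi\mu$. Then $\mathcal G=\{\log g_n\}_{n=1}^\infty$ is an asymptotically subadditive potential on $Y$ with bounded variation, $\nu$ is the unique invariant Gibbs measure for $\mathcal G$, $\nu$ is the unique equilibrium state for $\mathcal G$, $\nu$ is mixing, and $$P_X(\mathcal F)=\sup_{\bar\mu\in M(X,\sigma_X)}\Big\{h_{\bar\mu}(\sigma_X)+\lim_{n\to\infty}\tfrac1n\int\log f_n\,d\bar\mu\Big\}=\sup_{\bar\nu\in M(Y,\sigma_Y)}\Big\{h_{\bar\nu}(\sigma_Y)+\lim_{n\to\infty}\tfrac1n\int\log g_n\,d\bar\nu\Big\}=P_Y(\mathcal G).$$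
   Context: A one-sided subshift $(X,\sigma_X)$ is a closed set $X\subseteq\{1,\dots,k\}^{\mathbb N}$ with $\sigma_X(X)\subseteq X$, where $\sigma_X((x_n)_{n\ge1})=(x_{n+1})_{n\ge1}$; the metric is $d(x,x')=2^{-j}$ where $j$ is the largest integer with $x_i=x'_i$ for $1\le i\le j$ ($d=1$ if $x_1\neq x'_1$, $d=0$ if $x=x'$). $B_n(X)$ is the set of words of length $n$ occurring in points of $X$; $[x_1\cdots x_n]=\{x'\in X:x'_i=x_i,1\le i\le n\}$. $X$ has the specification property if there is $p>0$ such that for any allowable words $u,v$ there is a word $w$ of length $p$ with $uwv$ allowable. A factor map is a continuous surjection $\pi:X\to Y$ with $\pi\circ\sigma_X=\sigma_Y\circ\pi$; it is assumed one-block ($\pi(x)_i$ depends only on $x_i$), so it acts letterwise on words. $M(X,\sigma_X)$ denotes the invariant Borel probability measures, $h_\mu$ the entropy, $\pi\mu=\mu\circ\pi^{-1}$. A sequence $\Phi=\{\log\phi_n\}$ of continuous $\phi_n:X\to(0,\infty)$ is subadditive if $\phi_{n+m}(x)\le\phi_n(x)\phi_m(\sigma_X^nx)$ for all $x,n,m$; almost additive if there is $C>0$ with $e^{-C}\phi_n(x)\phi_m(\sigma_X^nx)\le\phi_{n+m}(x)\le e^{C}\phi_n(x)\phi_m(\sigma_X^nx)$ for all $x,n,m$; asymptotically subadditive if for every $\epsilon>0$ there is a subadditive $\{\log\psi_n\}$ with $\limsup_n\frac1n\sup_x|\log\phi_n(x)-\log\psi_n(x)|\le\epsilon$. $\Phi$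 has bounded variation if $\sup_n\sup\{\phi_n(x)/\phi_n(x'):x_i=x'_i,1\le i\le n\}<\infty$. The pressure is $P_X(\Phi)=\lim_{\epsilon\to0}\limsup_n\frac1n\log\sup_E\sum_{x\in E}\phi_n(x)$, the sup over $(n,\epsilon)$-separated sets $E$ (distinct $x,y\in E$ have $\max_{0\le i<n}d(\sigma^ix,\sigma^iy)>\epsilon$). For asymptotically subadditive $\Phi$ the variational principle $P_X(\Phi)=\sup_\mu\{h_\mu+\lim_n\frac1n\int\log\phi_nd\mu\}$ holds; an equilibrium state is a $\mu\in M(X,\sigma_X)$ attaining the sup. A Borel probability measure $\mu$ is a Gibbs measure for $\Phi$ if there is $C_0>0$ with $C_0^{-1}<\mu([x_1\cdots x_n])/(e^{-nP_X(\Phi)}\phi_n(x))<C_0$ for all $x\in X$, $n\in\mathbb N$. (Known: if $X$ has specification and $\Phi$ is almost additive with bounded variation, there is a unique invariant Gibbs measure for $\Phi$.) Construction: for $y\in Y$ and $n\in\mathbb N$, $E_n(y)$ denotes any set consisting of exactly one point from each cylinder $[x_1\cdots x_n]$ of $X$ with $\pi([x_1\cdots x_n])\subseteq[y_1\cdots y_n]$, and $g_n(y)=\sup_{E_n(y)}\sum_{x\in E_n(y)}f_n(x)$, the supremum over all such choices of $E_n(y)$; $\mathcal G=\{\log g_n\}_{n\ge1}$. *)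

(* Defs.v *)
From HB Require Import structures.
From mathcomp Require Import all_boot all_order all_algebra.
From mathcomp Require Import all_classical all_reals all_analysis.

Set Implicit Arguments.
Unset Strict Implicit.
Unset Printing Implicit Defensive.

Import Order.TTheory GRing.Theory Num.Theory.
Import numFieldNormedType.Exports.
Local Open Scope classical_set_scope.
Local Open Scope ring_scope.

(* Full shift on the alphabet {1,...,k+1} (represented by 'I_k.+1).         *)
(* A point x = (x_1, x_2, ...) is a function nat -> 'I_k.+1 with x_{i+1}    *)
(* stored at index i (0-based).                                             *)
Definition pts (k : nat) := nat -> 'I_k.+1.
HB.instance Definition _ k := gen_eqMixin (pts k).
HB.instance Definition _ k := gen_choiceMixin (pts k).
HB.instance Definition _ k := isPointed.Build (pts k) (fun _ => ord0).

Definition sshift {k} (x : pts k) : pts k := fun n => x n.+1.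

Definition pref {k} (n : nat) (x : pts k) : seq 'I_k.+1 := mkseq x n.

(* Borel sigma-algebra of the full shift = sigma-algebra generated by cylinders *)
Definition cylinders (k : nat) : set (set (pts k)) :=
  [set [set x : pts k | pref (size w) x = w] | w in [set: seq 'I_k.+1]].
Notation MT k := (g_sigma_algebraType (@cylinders k)).

Section Subshifts.
Context {R : realType}.

(* the metric d(x,x') = 2^{-j}, j the length of the longest common prefix,
   written as the supremum of 2^{-i} over the (0-based) indices i where x, x'
   differ: the smallest such i equals j; sup of the empty set is 0 (x = x'). *)
Definition dist {k} (x y : pts k) : R :=
  sup [set (2%:R ^- i : R) | i in [set i : nat | x i != y i]].

Definition closed_set {k} (X : set (pts k)) : Prop :=
  forall x, (forall e : R, 0 < e -> exists2 x', X x' & dist x x' < e) -> X x.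

Definition subshift {k} (X : set (pts k)) : Prop :=
  closed_set X /\ (forall x, X x -> X (sshift x)).

Definition allowable {k} (X : set (pts k)) (u : seq 'I_k.+1) : Prop :=
  exists2 x, X x & exists m, u = mkseq (fun i => x (m + i)%N) (size u).

Definition B {k} (n : nat) (X : set (pts k)) : set (seq 'I_k.+1) :=
  [set u | size u = n /\ allowable X u].

Definition specification {k} (X : set (pts k)) : Prop :=
  exists2 p : nat, (0 < p)%N & forall u v, allowable X u -> allowable X v ->
    exists w, size w = p /\ allowable X (u ++ w ++ v).

Definition cyl {k} (X : set (pts k)) (w : seq 'I_k.+1) : set (pts k) :=
  [set x | X x /\ pref (size w) x = w].

Definition continuous_on {k} (X : set (pts k)) (f : pts k -> R) : Prop :=
  forall x, X x -> forall e : R, 0 < e -> exists2 d : R, 0 < d &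
    forall x', X x' -> dist x x' < d -> `|f x - f x'| < e.

Definition potential {k} (X : set (pts k)) (phi : nat -> pts k -> R) : Prop :=
  forall n, (0 < n)%N -> (forall x, X x -> 0 < phi n x) /\ continuous_on X (phi n).

Definition subadd_pot {k} (X : set (pts k)) (phi : nat -> pts k -> R) : Prop :=
  potential X phi /\
  forall n m x, (0 < n)%N -> (0 < m)%N -> X x ->
    phi (n + m)%N x <= phi n x * phi m (iter n sshift x).

Definition almost_additive {k} (X : set (pts k)) (phi : nat -> pts k -> R) : Prop :=
  potential X phi /\
  exists2 C : R, 0 < C & forall n m x, (0 < n)%N -> (0 < m)%N -> X x ->
    expR (- C) * phi n x * phi m (iter n sshift x) <= phi (n + m)%N x /\
    phi (n + m)%N x <= expR C * phi n x * phi m (iter n sshift x).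

Definition asymp_subadditive {k} (X : set (pts k)) (phi : nat -> pts k -> R) : Prop :=
  potential X phi /\
  forall e : R, 0 < e -> exists psi, subadd_pot X psi /\
    (limn_esup (fun n : nat => (n%:R^-1)%:E *
       ereal_sup [set (`|ln (phi n x) - ln (psi n x)|)%:E | x in X]) <= e%:E)%E.

Definition bdd_variation {k} (X : set (pts k)) (phi : nat -> pts k -> R) : Prop :=
  exists M : R, forall n x x', (0 < n)%N -> X x -> X x' -> pref n x = pref n x' ->
    phi n x / phi n x' <= M.

Definition nsep {k} (X : set (pts k)) (n : nat) (e : R) (E : seq (pts k)) : Prop :=
  uniq E /\ (forall x, x \in E -> X x) /\
  forall x y, x \in E -> y \in E -> x <> y ->
    exists2 i, (i < n)%N & e < dist (iter i sshift x) (iter i sshift y).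

Definition pressure {k} (X : set (pts k)) (phi : nat -> pts k -> R) : \bar R :=
  lim ((fun e : R => limn_esup (fun n : nat =>
      (n%:R^-1 * ln (sup [set \sum_(x <- E) phi n x | E in nsep X n e]))%:E))
    @ 0^'+).

Definition mshift {k} (x : MT k) : MT k := sshift x.

(* Borel probability measures on X = probabilities on the full shift
   giving full mass to X; M(X,sigma_X) = the sigma-invariant ones *)
Definition invariant_measure {k} (X : set (pts k)) (P : probability (MT k) R) : Prop :=
  P X = 1%E /\ forall E : set (MT k), measurable E -> P (mshift @^-1` E) = P E.

Definition same_measure {k} (P Q : probability (MT k) R) : Prop :=
  forall E : set (MT k), measurable E -> P E = Q E.

Definition partition {k} (m : nat) (xi : 'I_m -> set (MT k)) : Prop :=
  (forall i, measurable (xi i)) /\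
  (forall i j, i != j -> xi i `&` xi j = set0) /\
  \bigcup_(i in [set: 'I_m]) xi i = [set: MT k].

Definition join_elt {k} (m n : nat) (xi : 'I_m -> set (MT k)) (w : n.-tuple 'I_m)
  : set (MT k) :=
  \big[setI/setT]_(j < n) (iter j mshift @^-1` xi (tnth w j)).

Definition Hjoin {k} (P : probability (MT k) R) (m n : nat) (xi : 'I_m -> set (MT k)) : R :=
  \sum_(w : n.-tuple 'I_m)
     - (fine (P (join_elt xi w)) * ln (fine (P (join_elt xi w)))).

Definition hpart {k} (P : probability (MT k) R) (m : nat) (xi : 'I_m -> set (MT k)) : R :=
  limn (fun n : nat => n%:R^-1 * Hjoin P n xi).

Definition entropy {k} (P : probability (MT k) R) : \bar R :=
  ereal_sup [set (hpart P (projT2 xi))%:E | xi in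
     [set xi : {m : nat & 'I_m -> set (MT k)} | partition (projT2 xi)] ]
  (* written with a dependent pair (m, xi) *).

Definition free_energy {k} (X : set (pts k)) (phi : nat -> pts k -> R)
  (P : probability (MT k) R) : \bar R :=
  (entropy P + limn (fun n : nat =>
     (n%:R^-1)%:E * \int[P]_(x in (X : set (MT k))) (ln (phi n x))%:E))%E.

Definition var_sup {k} (X : set (pts k)) (phi : nat -> pts k -> R) : \bar R :=
  ereal_sup [set free_energy X phi P | P in [set P | invariant_measure X P]].

Definition equilibrium_state {k} (X : set (pts k)) (phi : nat -> pts k -> R)
  (P : probability (MT k) R) : Prop :=
  invariant_measure X P /\ free_energy X phi P = var_sup X phi.

Definition gibbs {k} (X : set (pts k)) (phi : nat -> pts k -> R)
  (P : probability (MT k) R) : Prop :=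
  P X = 1%E /\
  exists2 Pr : R, pressure X phi = Pr%:E &
  exists2 C0 : R, 0 < C0 & forall x n, X x -> (0 < n)%N ->
    C0^-1 < fine (P (cyl X (pref n x))) / (expR (- (n%:R * Pr)) * phi n x) /\
    fine (P (cyl X (pref n x))) / (expR (- (n%:R * Pr)) * phi n x) < C0.

Definition mixing {k} (P : probability (MT k) R) : Prop :=
  forall E F : set (MT k), measurable E -> measurable F ->
    (fun n : nat => fine (P ((iter n mshift @^-1` E) `&` F)))
      @ \oo --> fine (P E) * fine (P F).

(* Index set of E_n(y): the words w such that [w] is a cylinder of X (w is  *)
(* the prefix of a point of X) with pi([w]) \subseteq [y_1...y_n]; a choice *)
(* E_n(y) is a choice c w \in [w] for each such w.                          *)
Definition factor_map {k l} (p : 'I_k.+1 -> 'I_l.+1) (x : pts k) : pts l :=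
  fun i => p (x i).

Definition En_index {k l} (X : set (pts k)) (Y : set (pts l))
  (p : 'I_k.+1 -> 'I_l.+1) (n : nat) (y : pts l) : set (n.-tuple 'I_k.+1) :=
  [set w | (exists2 x, X x & pref n x = w) /\
           factor_map p @` cyl X w `<=` cyl Y (pref n y)].

Definition gpot {k l} (X : set (pts k)) (Y : set (pts l))
  (p : 'I_k.+1 -> 'I_l.+1) (f : nat -> pts k -> R) (n : nat) (y : pts l) : R :=
  sup [set \sum_(w : n.-tuple 'I_k.+1 | `[< @En_index _ _ X Y p n y w >]) f n (c w)
      | c in [set c : n.-tuple 'I_k.+1 -> pts k |
                forall w, @En_index _ _ X Y p n y w -> cyl X w (c w)]].

End Subshifts.

(* Main.v *)
Require Import Defs.
From HB Require Import structures.
From mathcomp Require Import all_boot all_order all_algebra.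
From mathcomp Require Import all_classical all_reals all_analysis.
From mathcomp Require Import ring lra zify.
Import Order.TTheory GRing.Theory Num.Theory.
Import numFieldNormedType.Exports.
Local Open Scope classical_set_scope.
Local Open Scope ring_scope.

(** Only the law of words under mu matters. The Gibbs property and almost
    additivity make it quasi-Bernoulli, m (uv) <= K m u * m v, and specification
    gives the converse bound with a gap, sum_(|w| = p) m (uwv) >= c m u * m v.
    Both bounds survive the letterwise image p, so they hold for nu, and g_n is
    comparable to exp (n P) nu [y_1 .. y_n]; this yields the potential-theoretic
    claims and the Gibbs property.

    The gap bound makes the variance of ergodic averages contract when the
    length doubles. Applied to the product law on pairs of letters, which
    dominates the joint law of (x_j, x_{n+j}), it gives mixing. For an invariant
    nu', free energy minus P is - lim KL_n (nu' | nu) / n <= 0, computed on words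
    of length n. If it vanishes, then KL_n is bounded, because KL_n - ln K is
    superadditive, and the Gibbs variational inequality applied to squared
    ergodic averages forces nu' = nu. *)

Set Implicit Arguments.
Unset Strict Implicit.
Unset Printing Implicit Defensive.

(** * Words and stationary laws *)

(** The image nu need not be a Gibbs measure of an almost additive potential. The upper bound for
    adjacent words survives the factor map, but the matching lower bound may fail even when uv is
    allowable, since the preimages that carry the mass of u and of v need not concatenate. This is
    why the lower bound leaves a gap and is a bound on a sum over all gap words: in that form a
    letterwise image preserves it with the same constant. A third property, m w = 0 or d ^ |w| <= m
    w, keeps cross entropies from decaying faster than linearly, so that their rates are finite.

    Uniqueness uses neither ergodic decomposition nor a pointwise ergodic theorem. A competing Gibbs
    measure and a competing equilibrium state both yield a bound on KL_n uniform in n, and such a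
    bound is incompatible with ergodic averages that concentrate under nu at a value different from
    their mean under nu'.

    Entropy is a supremum over all finite measurable partitions. A coding inequality between labels
    identifies it with the entropy rate of the letters. *)

Section TupleSums.
Variables (R : nmodType) (A B : finType).
Implicit Types F : seq A -> R.

(** Summands are functions of plain sequences and tuples enter by coercion only, so the length index
    can be split or regrouped without casts. *)
Lemma big_tuple0 F : \sum_(w : 0.-tuple A) F w = F [::].
Proof.
rewrite (bigD1 [tuple]) //= big1 ?addr0 // => w /eqP[].
exact: tuple0.
Qed.

Lemma big_tupleS n F :
  \sum_(w : n.+1.-tuple A) F w = \sum_a \sum_(w : n.-tuple A) F (a :: w).
Proof.
rewrite pair_big /=.
rewrite (reindex (fun aw : A * n.-tuple A => [tuple of aw.1 :: aw.2])) //=.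
exists (fun t : n.+1.-tuple A => (thead t, [tuple of behead t])).
  by move=> [a w] _ /=; congr pair; apply/val_inj.
by move=> t _ /=; rewrite [RHS]tuple_eta; apply/val_inj.
Qed.

Lemma big_tuple_cat n m F :
  \sum_(w : (n + m).-tuple A) F w =
  \sum_(u : n.-tuple A) \sum_(v : m.-tuple A) F (u ++ v).
Proof.
elim: n F => [|n IH] F.
  by rewrite (big_tuple0 (fun u => \sum_(v : m.-tuple A) F (u ++ v))).
rewrite (big_tupleS n (fun u => \sum_(v : m.-tuple A) F (u ++ v))).
rewrite (big_tupleS (n + m) F); apply: eq_bigr => a _.
by rewrite (IH (fun w => F (a :: w))).
Qed.

Lemma big_tuple_rcons n F :
  \sum_(w : n.+1.-tuple A) F w = \sum_(w : n.-tuple A) \sum_a F (rcons w a).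
Proof.
rewrite -addn1 (big_tuple_cat n 1 F); apply: eq_bigr => w _.
rewrite (big_tupleS 0 (fun v => F (w ++ v))); apply: eq_bigr => a _.
by rewrite (big_tuple0 (fun v => F (w ++ (a :: v)))) cats1.
Qed.

End TupleSums.

Lemma big_tuple_unzip (R : nmodType) (A B : finType) n (F : seq A -> seq B -> R) :
  \sum_(w : n.-tuple (A * B)) F (unzip1 w) (unzip2 w) =
  \sum_(u : n.-tuple A) \sum_(v : n.-tuple B) F u v.
Proof.
elim: n F => [|n IH] F.
  rewrite (big_tuple0 (fun w => F (unzip1 w) (unzip2 w))).
  rewrite (big_tuple0 (fun u => \sum_(v : 0.-tuple B) F u v)).
  by rewrite (big_tuple0 (fun v => F [::] v)).
rewrite (big_tupleS n (fun w => F (unzip1 w) (unzip2 w))).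
rewrite (big_tupleS n (fun u => \sum_(v : n.+1.-tuple B) F u v)).
under eq_bigr => i _ do rewrite /= (IH (fun u v => F (i.1 :: u) (i.2 :: v))).
rewrite -(pair_bigA _ (fun a b => \sum_(u : n.-tuple A) \sum_(v : n.-tuple B)
   F (a :: u) (b :: v))) /=.
apply: eq_bigr => a _; rewrite exchange_big /=; apply: eq_bigr => u _.
by rewrite (big_tupleS n (fun v => F (a :: u) v)).
Qed.

Section Laws.
Variables (R : realType) (A : finType).
Implicit Types (q m : seq A -> R) (u v w : seq A).

(** Consistency on the right is that of the finite marginals of a measure; consistency on the left
    is its shift invariance. *)
Definition stationary_law q :=
  [/\ q [::] = 1, forall w, 0 <= q w, forall w, \sum_a q (a :: w) = q w
    & forall w, \sum_a q (rcons w a) = q w].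

Variables (q : seq A -> R) (sq : stationary_law q).

Lemma law_ge0 w : 0 <= q w. Proof. by case: sq. Qed.

Lemma law_suffix n u : \sum_(v : n.-tuple A) q (u ++ v) = q u.
Proof.
elim: n => [|n IH]; first by rewrite (big_tuple0 (fun v => q (u ++ v))) cats0.
rewrite (big_tuple_rcons n (fun v => q (u ++ v))) -[RHS]IH.
apply: eq_bigr => v _; case: sq => _ _ _ <-.
by apply: eq_bigr => a _; rewrite rcons_cat.
Qed.

Lemma law_prefix n u : \sum_(v : n.-tuple A) q (v ++ u) = q u.
Proof.
elim: n => [|n IH]; first by rewrite (big_tuple0 (fun v => q (v ++ u))).
rewrite (big_tupleS n (fun v => q (v ++ u))) exchange_big -[RHS]IH /=.
by apply: eq_bigr => v _; case: sq => _ _ <-.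
Qed.

Lemma law_total n : \sum_(w : n.-tuple A) q w = 1.
Proof. by rewrite (law_suffix n [::]); case: sq. Qed.

Lemma law_catl_le u v : q (u ++ v) <= q u.
Proof.
rewrite -(law_suffix (size v) u) (bigD1 (in_tuple v)) //= lerDl.
by apply: sumr_ge0 => *; apply: law_ge0.
Qed.

Lemma law_catr_le u v : q (u ++ v) <= q v.
Proof.
rewrite -(law_prefix (size u) v) (bigD1 (in_tuple u)) //= lerDl.
by apply: sumr_ge0 => *; apply: law_ge0.
Qed.

Lemma law_le1 w : q w <= 1.
Proof. by have := law_catl_le [::] w; case: sq => ->. Qed.

(** The a letters before the window and the b letters after it are summed out by the two consistency
    conditions, so the mean of F does not depend on the position of the window. *)
Lemma law_window a n b (F : seq A -> R) :
  \sum_(w : (a + (n + b)).-tuple A) q w * F (take n (drop a w)) =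
  \sum_(w : n.-tuple A) q w * F w.
Proof.
rewrite (big_tuple_cat a (n + b) (fun w => q w * F (take n (drop a w)))).
under eq_bigr => x _.
  rewrite (big_tuple_cat n b (fun w => q (x ++ w) * F (take n (drop a (x ++ w))))).
  under eq_bigr => w _.
    under eq_bigr => y _.
      rewrite drop_size_cat ?size_tuple // take_size_cat ?size_tuple // catA.
      over.
    rewrite -mulr_suml law_suffix; over.
  over.
rewrite exchange_big /=; apply: eq_bigr => w _.
by rewrite -mulr_suml law_prefix.
Qed.

End Laws.

Section Gibbs.
Variable R : realType.

(** This is 1 + t <= exp t at t = ln (b / a), multiplied by a. Summed over two probability vectors
    the correction b - a cancels, which gives nonnegativity of relative entropy; the condition on
    zeros is absolute continuity. *)
Lemma gibbs_ineq (a b : R) : 0 <= a -> 0 <= b -> (b = 0 -> a = 0) ->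
  - (a * ln a) <= - (a * ln b) + (b - a).
Proof.
rewrite [in X in X -> _]le_eqVlt => /predU1P[<-|a0] b0 ab.
  by rewrite !mul0r subr0 lerDl.
have {}b0 : 0 < b.
  by rewrite lt_neqAle b0 andbT eq_sym; apply/eqP => /ab a00; rewrite a00 ltxx in a0.
have := expR_ge1Dx (ln (b / a)); rewrite lnK ?posrE ?divr_gt0 //.
rewrite ln_div ?posrE // -(ler_pM2r a0) divfK ?gt_eqF // mulrDl mulrBl.
by rewrite mul1r ![_ * a]mulrC; lra.
Qed.

End Gibbs.

(** * Second moments of Birkhoff sums under a gap bound *)

Section BirkhoffSums.
Variables (R : realType) (A : finType) (phi : seq A -> R) (r : nat).

(** For r > 0 the N windows fit in N + r - 1 letters; words of length N + r are used instead, which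
    avoids truncated subtraction. *)
Definition bsum (N : nat) (w : seq A) : R :=
  \sum_(0 <= j < N) phi (take r (drop j w)).

Lemma bsum_cat N u v : size u = (N + r)%N -> bsum N (u ++ v) = bsum N u.
Proof.
move=> su; rewrite /bsum; apply: eq_big_nat => j /andP[_ jN].
have ju : (j < (size u).+1)%N by rewrite su ltnS; lia.
rewrite drop_cat; case: ltnP => [?|le]; first by rewrite takel_cat // size_drop su; lia.
have -> : r = 0%N by lia.
by rewrite !take0.
Qed.

(** The first N windows lie in u and the last N in v. The r + p windows in between are an error term
    whose size does not depend on N. *)
Lemma bsum_split N p u z v :
  size u = (N + r)%N -> size z = p -> size v = (N + r)%N ->
  bsum (N + (r + p) + N) (u ++ z ++ v) =
  bsum N u + \sum_(N <= j < N + (r + p)) phi (take r (drop j (u ++ z ++ v)))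
   + bsum N v.
Proof.
move=> su sz sv.
rewrite -(bsum_cat (z ++ v) su) /bsum.
rewrite (@big_cat_nat _ _ _ (N + (r + p))) //=; last by lia.
rewrite (@big_cat_nat _ _ _ N) //=; last by lia.
congr (_ + _); rewrite -{1}[(N + (r + p))%N]add0n big_addn addKn.
apply: eq_big_nat => j _; congr (phi (take r _)).
rewrite catA drop_cat size_cat su sz ifF; last by lia.
by congr drop; lia.
Qed.

Lemma bsum_mean q N : stationary_law q ->
  \sum_(w : (N + r).-tuple A) q w * bsum N w =
  N%:R * \sum_(w : r.-tuple A) q w * phi w.
Proof.
move=> sq; under eq_bigr => w _ do rewrite /bsum mulr_sumr.
rewrite exchange_big /= mulr_natl -[in RHS](subn0 N) -sumr_const_nat.
apply: eq_big_nat => j /andP[_ jN].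
have e : (N + r = j + (r + (N - j)))%N by lia.
by rewrite e; apply: law_window.
Qed.

Hypothesis phi1 : forall w, `|phi w| <= 1.

Lemma bsum_bound N w : `|bsum N w| <= N%:R.
Proof.
rewrite /bsum; apply: le_trans (ler_norm_sum _ _ _) _.
apply: le_trans (_ : _ <= \sum_(0 <= j < N) 1) _; first exact: ler_sum.
by rewrite sumr_const_nat subn0.
Qed.

Variables (q : seq A -> R) (sq : stationary_law q) (p : nat) (c : R).
Hypotheses (c0 : 0 < c)
  (qc : forall u v, c * q u * q v <= \sum_(w : p.-tuple A) q (u ++ w ++ v))
  (phi0 : \sum_(w : r.-tuple A) q w * phi w = 0).

Let a N := \sum_(w : (N + r).-tuple A) q w * bsum N w ^+ 2.

Lemma transitive_le1 : c <= 1.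
Proof.
have := qc [::] [::]; case: (sq) => -> _ _ _; rewrite !mulr1 /= => h.
apply: (le_trans h); rewrite -(law_total sq p).
by apply: ler_sum => w _; rewrite cats0.
Qed.

(* The lower bound makes the blocks u and v almost independent, so that the
   mean of (S u - S v)^2 is at least c times its value 2 * a N under the product
   law; the parallelogram law then beats the trivial factor 4. *)
Lemma variance_doubling N :
  a (N + (r + p) + N) <= (4%:R - c) * a N + (1 + 4%:R / c) * (r + p)%:R ^+ 2.
Proof.
pose d : R := (r + p)%:R.
pose U := (N + r).-tuple A; pose Z := p.-tuple A.
have e : (N + (r + p) + N + r = (N + r) + (p + (N + r)))%N by lia.
have cat3 F : \sum_(w : ((N + r) + (p + (N + r))).-tuple A) q w * F (w : seq A) =
   \sum_(u : U) \sum_(z : Z) \sum_(v : U) q (u ++ z ++ v) * F (u ++ z ++ v).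
  rewrite (big_tuple_cat _ _ (fun w => q w * F w)); apply: eq_bigr => u _.
  by rewrite (big_tuple_cat _ _ (fun w => q (u ++ w) * F (u ++ w))).
have qge := law_ge0 sq.
pose S := bsum N.
have Ea : \sum_(u : U) \sum_(z : Z) \sum_(v : U) q (u ++ z ++ v) * S u ^+ 2 = a N.
  apply: eq_bigr => u _; rewrite -(law_suffix sq (p + (N + r)) u) mulr_suml.
  by rewrite (big_tuple_cat _ _ (fun w => q (u ++ w) * S u ^+ 2)).
have Eb : \sum_(u : U) \sum_(z : Z) \sum_(v : U) q (u ++ z ++ v) * S v ^+ 2 = a N.
  under eq_bigr => u _ do rewrite exchange_big /=.
  rewrite exchange_big /=; apply: eq_bigr => v _.
  rewrite -(law_prefix sq (N + r + p) v) mulr_suml.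
  rewrite (big_tuple_cat _ _ (fun w => q (w ++ v) * S v ^+ 2)).
  by apply: eq_bigr => u _; apply: eq_bigr => z _; rewrite -catA.
have mean0 : \sum_(u : U) q u * S u = 0 by rewrite bsum_mean // phi0 mulr0.
(* Under the product law the cross term of the square vanishes because phi is centred, so the mean
   of the square is exactly 2 * a N. *)
have Ec : c * (2%:R * a N) <=
   \sum_(u : U) \sum_(z : Z) \sum_(v : U) q (u ++ z ++ v) * (S u - S v) ^+ 2.
  have -> : c * (2%:R * a N) =
      \sum_(u : U) \sum_(v : U) (c * q u * q v) * (S u - S v) ^+ 2.
    have E1 (u : U) : \sum_(v : U) (c * q u * q v) * (S u - S v) ^+ 2 =
        c * (q u * S u ^+ 2) + c * (q u * a N).
      have -> : \sum_(v : U) (c * q u * q v) * (S u - S v) ^+ 2 =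
        \sum_(v : U) (c * (q u * S u ^+ 2) * q v - 2%:R * c * q u * S u * (q v * S v)
            + c * q u * (q v * S v ^+ 2)).
        by apply: eq_bigr => v _; ring.
      rewrite big_split big_split /= sumrN -!mulr_sumr mean0 (law_total sq).
      rewrite -/(a N); ring.
    under eq_bigr => u _ do rewrite E1.
    rewrite big_split /= -!mulr_sumr -mulr_suml (law_total sq).
    by rewrite -/(a N); ring.
  apply: ler_sum => u _; rewrite exchange_big; apply: ler_sum => v _ /=.
  by rewrite -mulr_suml ler_wpM2r ?sqr_ge0.
(* Weighted Young inequality. The weight c / 4 is chosen so that (1 + c/4) * (4 - 2c) = 4 - c -
   c^2/2, which is at most 4 - c. *)
have pt : forall x z : R, `|z| <= d ->
    (x + z) ^+ 2 <= (1 + c / 4%:R) * x ^+ 2 + (1 + 4%:R / c) * d ^+ 2.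
  move=> x z zd.
  have zz : z ^+ 2 <= d ^+ 2.
    by rewrite -(real_normK (num_real z)) lerXn2r ?nnegrE // ler0n.
  apply: le_trans (_ : _ <= (1 + c / 4%:R) * x ^+ 2 + (1 + 4%:R / c) * z ^+ 2) _.
    rewrite -subr_ge0.
    have -> : (1 + c / 4%:R) * x ^+ 2 + (1 + 4%:R / c) * z ^+ 2 - (x + z) ^+ 2 =
      c / 4%:R * (x - 4%:R / c * z) ^+ 2 by field; rewrite gt_eqF.
    by rewrite mulr_ge0 ?sqr_ge0 // divr_ge0 // ltW.
  rewrite lerD2l ler_wpM2l // addr_ge0 // divr_ge0 // ltW //.
rewrite /a e (cat3 (fun w => bsum (N + (r + p) + N) w ^+ 2)).
pose t : R := 1 + c / 4%:R.
pose D : R := (1 + 4%:R / c) * d ^+ 2.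
apply: (@le_trans _ _ (\sum_(u : U) \sum_(z : Z) \sum_(v : U)
   (t * (q (u ++ z ++ v) * S u ^+ 2) *+ 2 + t * (q (u ++ z ++ v) * S v ^+ 2) *+ 2
    - t * (q (u ++ z ++ v) * (S u - S v) ^+ 2) + q (u ++ z ++ v) * D))).
  apply: ler_sum => u _; apply: ler_sum => z _; apply: ler_sum => v _.
  rewrite bsum_split ?size_tuple // -/(S u) -/(S v).
  set s := (\sum_(N <= _ < _) _).
  have sd : `|s| <= d.
    rewrite /s; apply: le_trans (ler_norm_sum _ _ _) _.
    apply: le_trans (_ : _ <= \sum_(N <= j < N + (r + p)) 1) _; first exact: ler_sum.
    by rewrite sumr_const_nat addKn.
  have := pt (S u + S v) s sd; rewrite -/t -/D => hpt.
  have := ler_wpM2l (qge (u ++ z ++ v)) hpt.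
  rewrite addrAC => /le_trans; apply.
  by rewrite le_eqVlt; apply/orP; left; apply/eqP; ring.
do 3 (under eq_bigr => u _ do under eq_bigr => z _ do rewrite big_split /=;
      under eq_bigr => u _ do rewrite big_split /=; rewrite big_split /=).
have pull (F : U -> Z -> U -> R) : \sum_(u : U) \sum_(z : Z) \sum_(v : U) t * F u z v
   = t * \sum_(u : U) \sum_(z : Z) \sum_(v : U) F u z v.
  rewrite mulr_sumr; apply: eq_bigr => u _; rewrite mulr_sumr; apply: eq_bigr => z _.
  by rewrite mulr_sumr.
have pull2 (F : U -> Z -> U -> R) : \sum_(u : U) \sum_(z : Z) \sum_(v : U) F u z v *+ 2
   = (\sum_(u : U) \sum_(z : Z) \sum_(v : U) F u z v) *+ 2.
  rewrite -sumrMnl; apply: eq_bigr => u _; rewrite -sumrMnl; apply: eq_bigr => z _.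
  by rewrite -sumrMnl.
have pullN (F : U -> Z -> U -> R) : \sum_(u : U) \sum_(z : Z) \sum_(v : U) - F u z v
   = - (\sum_(u : U) \sum_(z : Z) \sum_(v : U) F u z v).
  rewrite -sumrN; apply: eq_bigr => u _; rewrite -sumrN; apply: eq_bigr => z _.
  by rewrite -sumrN.
rewrite !pull2 pullN !pull Ea Eb.
have -> : \sum_(u : U) \sum_(z : Z) \sum_(v : U) q (u ++ z ++ v) * D = D.
  transitivity (\sum_(u : U) q u * D); last by rewrite -mulr_suml (law_total sq) mul1r.
  apply: eq_bigr => u _; rewrite -(law_suffix sq (p + (N + r)) u) mulr_suml.
  by rewrite (big_tuple_cat _ _ (fun w => q (u ++ w) * D)).
rewrite -/(a N) -/D lerD2r.
have a0 : 0 <= a N by apply: sumr_ge0 => w _; rewrite mulr_ge0 ?qge ?sqr_ge0.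
have t0 : 0 <= t by rewrite addr_ge0 // divr_ge0 // ltW.
have := ler_wpM2l t0 Ec.
set X := (\sum_(u : U) _).
move=> h; apply: (@le_trans _ _ (t * (4%:R - 2%:R * c) * a N)); first by move: h; lra.
rewrite ler_wpM2r // /t.
by have := sqr_ge0 c; lra.
Qed.

(** If all the normalised moments a N / N^2 exceeded e, the additive error of [variance_doubling]
    would be negligible for large N, and passing from N to 2N + r + p would multiply the normalised
    moment by at most 1 - c/8. This is impossible near the infimum of these moments, which is at
    least e. *)
Lemma variance_small e : 0 < e -> exists2 N, (0 < N)%N &
  \sum_(w : (N + r).-tuple A) q w * (bsum N w / N%:R) ^+ 2 <= e.
Proof.
move=> e0.
have Ea N : \sum_(w : (N + r).-tuple A) q w * (bsum N w / N%:R) ^+ 2 = a N / N%:R ^+ 2.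
  by rewrite /a mulr_suml; apply: eq_bigr => w _; rewrite expr_div_n mulrA.
apply: contrapT => /forallPNP hN.
have big N : (0 < N)%N -> e < a N / N%:R ^+ 2.
  by move=> N0; rewrite -Ea ltNge; apply/negP; apply: hN.
have a0 N : 0 <= a N.
  by apply: sumr_ge0 => w _; rewrite mulr_ge0 ?(law_ge0 sq) ?sqr_ge0.
pose D := (1 + 4%:R / c) * (r + p)%:R ^+ 2.
(* For N >= N0 the assumed bound a N > e * N^2 >= e * N makes D at most (c / 2) * a N. *)
pose N0 := (Num.truncn (2%:R * D / (c * e))).+1.
have c1 := transitive_le1.
have step N : (N0 <= N)%N ->
   a (N + (r + p) + N) / (N + (r + p) + N)%:R ^+ 2 <= (1 - c / 8%:R) * (a N / N%:R ^+ 2).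
  move=> NN; have N_gt0 : (0 < N)%N by apply: leq_trans NN.
  have Nr : 0 < N%:R :> R by rewrite ltr0n.
  have DN : D <= c / 2%:R * a N.
    have := big N N_gt0; rewrite ltr_pdivlMr ?exprn_gt0 // => h.
    have h1 : 2%:R * D / (c * e) < N%:R.
      by apply: lt_le_trans (truncnS_gt _) _; rewrite ler_nat.
    have h2 : (N%:R : R) <= N%:R ^+ 2 by rewrite expr2 ler_peMr ?ler0n // ler1n.
    move: h1; rewrite ltr_pdivrMr ?mulr_gt0 // => h1.
    have h3 : N%:R * (c * e) <= N%:R ^+ 2 * (c * e) by rewrite ler_wpM2r // ltW // mulr_gt0.
    have h4 : c * (e * N%:R ^+ 2) <= c * a N by rewrite ler_wpM2l // ltW.
    by lra.
  have h := variance_doubling N; rewrite -/D in h.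
  have {}h : a (N + (r + p) + N) <= (4%:R * (1 - c / 8%:R)) * a N by lra.
  rewrite ler_pdivrMr; last by rewrite exprn_gt0 // ltr0n; lia.
  apply: (le_trans h).
  have k4 : 4%:R * a N <= a N / N%:R ^+ 2 * (N + (r + p) + N)%:R ^+ 2.
    rewrite mulrAC ler_pdivlMr ?exprn_gt0 // mulrC mulrA [X in _ <= X]mulrC ler_wpM2r //.
    have -> : N%:R ^+ 2 * 4%:R = (2 * N)%:R ^+ 2 :> R by rewrite natrM; ring.
    by rewrite lerXn2r ?nnegrE ?ler0n // ler_nat; lia.
  have c8 : 0 <= 1 - c / 8%:R by lra.
  by have := ler_wpM2l c8 k4; lra.
pose B := [set x | exists2 N, (N0 <= N)%N & x = a N / N%:R ^+ 2].
have lbB : lbound B e.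
  by move=> x [N NN ->]; apply/ltW/big/(leq_trans _ NN).
have hB : has_inf B by split; [exists (a N0 / N0%:R ^+ 2), N0 | exists e].
have ib : e <= inf B by apply: lb_le_inf => //; case: hB.
have i0 : 0 < inf B by apply: lt_le_trans ib.
(* A value within the factor 1 + c/8 of the infimum is contracted by 1 - c/8, and the product 1 -
   (c/8)^2 is below 1. *)
have i8 : 0 < inf B * (c / 8%:R) by rewrite mulr_gt0 // divr_gt0.
have [x [N NN ->] hx] := inf_adherent i8 hB.
have inB : B (a (N + (r + p) + N) / (N + (r + p) + N)%:R ^+ 2).
  by exists (N + (r + p) + N)%N => //; lia.
have := ge_inf (proj2 hB) inB.
apply/negP; rewrite -ltNge; apply: (le_lt_trans (step _ NN)).
apply: (@lt_le_trans _ _ ((1 - c / 8%:R) * (inf B + inf B * (c / 8%:R)))).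
  by rewrite ltr_pM2l //; lra.
have -> : (1 - c / 8%:R) * (inf B + inf B * (c / 8%:R)) =
  inf B - inf B * (c / 8%:R) ^+ 2 by ring.
by rewrite gerBl mulr_ge0 ?sqr_ge0 // ltW.
Qed.

End BirkhoffSums.

(** * Entropy and divergence of word laws *)

Section Fekete.
Variable R : realType.

(** The limit is the infimum of a n / n. The second conclusion records this: it turns knowledge of
    the rate into a bound at every n. *)
Lemma fekete (a : nat -> R) (b : R) :
  (forall n m, a (n + m)%N <= a n + a m) -> (forall n, - (b * n%:R) <= a n) ->
  exists2 L : R, (fun n => n%:R^-1 * a n) @ \oo --> L & forall n, n%:R * L <= a n.
Proof.
move=> sub lb.
pose S := [set x | exists2 n, (0 < n)%N & x = a n / n%:R].
have hS : has_inf S.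
  split; first by exists (a 1%N / 1%:R), 1%N.
  exists (- b) => x [n n0 ->]; rewrite ler_pdivlMr ?ltr0n //.
  by rewrite mulNr.
have Lle n : n%:R * inf S <= a n.
  case: n => [|n]; first by rewrite mul0r; have := sub 0%N 0%N; rewrite addn0; lra.
  have := ge_inf (proj2 hS) (ex_intro2 _ _ n.+1 isT erefl).
  by rewrite ler_pdivlMr ?ltr0n // mulrC.
exists (inf S) => //; apply/cvgrPdist_le => e e0.
have e2 : 0 < e / 2%:R by rewrite divr_gt0.
have [x [N N0 ->] hx] := inf_adherent e2 hS.
set s := a N / N%:R in hx.
have Nr : 0 < N%:R :> R by rewrite ltr0n.
have aN : a N = N%:R * s by rewrite /s mulrC divfK // gt_eqF.
have mulq q r : a (q * N + r)%N <= q%:R * a N + a r.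
  elim: q => [|q IH]; first by rewrite mul0n mul0r add0r add0n.
  by rewrite mulSn -addnA; apply: (le_trans (sub _ _)); rewrite -natr1; lra.
pose M := \sum_(r < N) `|a r|.
(* Cost of the remainder r = n mod N: the term a r, and the part r * s lost when q * N is replaced
   by n. *)
pose C := M + N%:R * `|s|.
have C0 : 0 <= C by rewrite addr_ge0 ?sumr_ge0 // mulr_ge0.
have aC n : a n <= n%:R * s + C.
  have := mulq (n %/ N)%N (n %% N)%N; rewrite -divn_eq => /le_trans; apply.
  have rN : (n %% N < N)%N by rewrite ltn_mod.
  have h1 : a (n %% N)%N <= M.
    apply: (le_trans (ler_norm _)).
    by rewrite /M (bigD1 (Ordinal rN)) //= lerDl sumr_ge0.
  have h2 : (n %/ N)%:R * a N = n%:R * s - (n %% N)%:R * s.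
    have -> : n%:R = (n %/ N)%:R * N%:R + (n %% N)%:R :> R by rewrite -natrM -natrD -divn_eq.
    by rewrite aN; ring.
  have h3 : - ((n %% N)%:R * s) <= N%:R * `|s|.
    apply: (le_trans (ler_norm _)); rewrite normrN normrM ler_pM // normr_nat.
    by rewrite ler_nat ltnW.
  by rewrite h2 /C; lra.
near=> n.
have n0 : 0 < n%:R :> R by rewrite ltr0n; near: n; apply: nbhs_infty_gt.
have nC : C <= n%:R * (e / 2%:R).
  rewrite -ler_pdivrMr //; apply: ltW; apply: (lt_le_trans (truncnS_gt _)).
  by rewrite ler_nat; near: n; apply: nbhs_infty_ge.
rewrite ler_distl; apply/andP; split.
  rewrite lerBlDr mulrC ler_pdivrMr // mulrDl.
  by have := aC n; have := ler_wpM2l (ltW n0) (ltW hx); lra.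
apply: le_trans (_ : _ <= n%:R^-1 * a n) _; last by rewrite lerDl ltW.
by rewrite mulrC ler_pdivlMr // mulrC.
Unshelve. all: by end_near. Qed.

End Fekete.

(** * Detecting the probability of a word by ergodic averages *)

Section Deviation.
Variables (R : realType) (A : finType).
Implicit Types (q : seq A -> R) (u w : seq A) (s : R).

Definition ind_dev u s w : R := (w == u)%:R - s.

Lemma ind_dev_le1 u s w : 0 <= s <= 1 -> `|ind_dev u s w| <= 1.
Proof.
move=> /andP[s0 s1].
by rewrite /ind_dev ler_norml; case: eqP => _ /=; rewrite ?mulr1n ?mulr0n; lra.
Qed.

Lemma ind_dev_mean q u s : stationary_law q ->
  \sum_(w : (size u).-tuple A) q w * ind_dev u s w = q u - s.
Proof.
move=> sq.
transitivity (\sum_(w : (size u).-tuple A) (q w * (w == in_tuple u)%:R - q w * s)).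
  by apply: eq_bigr => w _; rewrite /ind_dev mulrBr -val_eqE.
rewrite sumrB -mulr_suml (law_total sq) mul1r; congr (_ - _).
rewrite (bigD1 (in_tuple u)) //= eqxx mulr1 big1 ?addr0 // => w /negPf ->.
by rewrite mulr0.
Qed.

(** The ergodic average has mean q u - s under q, and the square of a mean is at most the second
    moment. With s the probability of u under another law, a small second moment shows that the two
    laws nearly agree on u. *)
Lemma ind_dev_sq q u s N : stationary_law q -> (0 < N)%N ->
  (q u - s) ^+ 2 <= \sum_(w : (N + size u).-tuple A)
    q w * (bsum (ind_dev u s) (size u) N w / N%:R) ^+ 2.
Proof.
move=> sq N0; pose W := (N + size u).-tuple A.
have Nr : 0 < N%:R :> R by rewrite ltr0n.
pose a (w : W) := bsum (ind_dev u s) (size u) N w / N%:R.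
have mean : \sum_(w : W) q w * a w = q u - s.
  rewrite -(ind_dev_mean u s sq) /a; under eq_bigr => w _ do rewrite mulrA.
  by rewrite -mulr_suml bsum_mean // mulrAC divff ?mul1r // gt_eqF.
have : 0 <= \sum_(w : W) q w * (a w - (q u - s)) ^+ 2.
  by apply: sumr_ge0 => w _; rewrite mulr_ge0 ?sqr_ge0 // (law_ge0 sq).
have -> : \sum_(w : W) q w * (a w - (q u - s)) ^+ 2 =
  \sum_(w : W) (q w * a w ^+ 2 - 2%:R * (q u - s) * (q w * a w) + q w * (q u - s) ^+ 2).
  by apply: eq_bigr => w _; ring.
rewrite big_split sumrB -mulr_sumr mean -mulr_suml (law_total sq) /=.
rewrite -/(W) -/(a _) mul1r; set V := (\sum_(i : W) _).
by rewrite (_ : V - 2%:R * (q u - s) * (q u - s) + (q u - s) ^+ 2 = V - (q u - s) ^+ 2)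
  ?subr_ge0 //; ring.
Qed.

End Deviation.

Section Entropy.
Variables (R : realType) (A : finType).
Implicit Types (q m : seq A -> R) (u v w : seq A).

Definition Hlaw q n : R := \sum_(w : n.-tuple A) - (q w * ln (q w)).
(** Cross entropy with the opposite sign, so that [Hlaw q n + Hcross q m n] is minus the relative
    entropy of q with respect to m on words of length n. *)
Definition Hcross q m n : R := \sum_(w : n.-tuple A) q w * ln (m w).

Lemma Hlaw_ge0 q n : stationary_law q -> 0 <= Hlaw q n.
Proof.
move=> sq; apply: sumr_ge0 => w _; rewrite -mulrN mulr_ge0 ?(law_ge0 sq) //.
by rewrite oppr_ge0 ln_le0 // (law_le1 sq).
Qed.

(** The law of words of length n + m has nonnegative relative entropy with respect to the product of
    its two marginals. *)
Lemma Hlaw_subadd q (n m : nat) : stationary_law q ->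
  Hlaw q (n + m) <= Hlaw q n + Hlaw q m.
Proof.
move=> sq; have q0 := law_ge0 sq.
rewrite /Hlaw (big_tuple_cat n m (fun w => - (q w * ln (q w)))).
apply: (@le_trans _ _ (\sum_(u : n.-tuple A) \sum_(v : m.-tuple A)
   (- (q (u ++ v) * ln (q u)) - (q (u ++ v) * ln (q v)) + (q u * q v - q (u ++ v))))).
  apply: ler_sum => u _; apply: ler_sum => v _.
  have z : q u * q v = 0 -> q (u ++ v) = 0.
    move=> /eqP; rewrite mulf_eq0 => /orP[] /eqP e; apply/eqP; rewrite eq_le q0 andbT -e.
      exact: law_catl_le.
    exact: law_catr_le.
  apply: (le_trans (gibbs_ineq (q0 _) (mulr_ge0 (q0 _) (q0 _)) z)).
  rewrite lerD2r; have [/z ->|nz] := eqVneq (q u * q v) 0; first by rewrite !mul0r subr0.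
  have [qu qv] : 0 < q u /\ 0 < q v.
    by move: nz; rewrite mulf_eq0 negb_or => /andP[a b]; rewrite !lt_neqAle !q0 ![0 == _]eq_sym a b.
  by rewrite lnM ?posrE // mulrDr opprD.
do 2 (under eq_bigr => u _ do rewrite big_split /=; rewrite big_split /=).
have -> : \sum_(u : n.-tuple A) \sum_(v : m.-tuple A) (q u * q v - q (u ++ v)) = 0.
  transitivity (\sum_(u : n.-tuple A) 0 : R); last by rewrite big1.
  apply: eq_bigr => u _; rewrite sumrB -mulr_sumr (law_total sq) (law_suffix sq); ring.
rewrite addr0; apply: lerD; rewrite le_eqVlt; apply/orP; left; apply/eqP.
  by apply: eq_bigr => u _; rewrite sumrN -mulr_suml (law_suffix sq).
rewrite exchange_big /=; apply: eq_bigr => v _.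
by rewrite sumrN -mulr_suml (law_prefix sq).
Qed.

Variables (q m : seq A -> R) (sq : stationary_law q) (sm : stationary_law m).
Hypothesis ac : forall w, m w = 0 -> q w = 0.

Lemma HDcross_le0 n : Hlaw q n + Hcross q m n <= 0.
Proof.
rewrite /Hlaw /Hcross -big_split /=.
apply: (@le_trans _ _ (\sum_(w : n.-tuple A) (m w - q w))).
  apply: ler_sum => w _.
  by have := gibbs_ineq (law_ge0 sq w) (law_ge0 sm w) (@ac w); lra.
by rewrite sumrB !law_total // subrr.
Qed.

Lemma Hcross_subadd (K : R) a b : 1 <= K ->
  (forall u v, m (u ++ v) <= K * m u * m v) ->
  Hcross q m (a + b) <= Hcross q m a + Hcross q m b + ln K.
Proof.
move=> K1 hK; have m0 := law_ge0 sm.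
have K0 : 0 < K by apply: lt_le_trans K1.
rewrite /Hcross (big_tuple_cat a b (fun w => q w * ln (m w))).
apply: (@le_trans _ _ (\sum_(u : a.-tuple A) \sum_(v : b.-tuple A)
   (q (u ++ v) * ln (m u) + q (u ++ v) * ln (m v) + q (u ++ v) * ln K))).
  apply: ler_sum => u _; apply: ler_sum => v _.
  have [/ac ->|nz] := eqVneq (m (u ++ v)) 0; first by rewrite !mul0r !addr0.
  have muv : 0 < m (u ++ v) by rewrite lt_neqAle eq_sym nz m0.
  have mu : 0 < m u by apply: (lt_le_trans muv); apply: law_catl_le.
  have mv : 0 < m v by apply: (lt_le_trans muv); apply: law_catr_le.
  rewrite -!mulrDr ler_wpM2l ?(law_ge0 sq) //.
  rewrite addrC addrA -!lnM ?posrE ?mulr_gt0 // ler_ln ?posrE ?mulr_gt0 //.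
do 2 (under eq_bigr => u _ do rewrite big_split /=; rewrite big_split /=).
rewrite le_eqVlt; apply/orP; left; apply/eqP; congr (_ + _ + _).
- by apply: eq_bigr => u _; rewrite -mulr_suml (law_suffix sq).
- rewrite exchange_big /=; apply: eq_bigr => v _.
  by rewrite -mulr_suml (law_prefix sq).
- under eq_bigr => u _ do rewrite -mulr_suml (law_suffix sq).
  by rewrite -mulr_suml (law_total sq) mul1r.
Qed.

(** The linear lower bound that [fekete] asks for; words with m w = 0 contribute nothing, by
    absolute continuity. *)
Lemma Hcross_ge (d : R) n : 0 < d -> (forall w, m w = 0 \/ d ^+ size w <= m w) ->
  - (- ln d * n%:R) <= Hcross q m n.
Proof.
move=> d0 hd; rewrite mulNr opprK.
rewrite -[X in X <= _]mul1r -[X in X * _](law_total sq n) mulr_suml.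
apply: ler_sum => w _.
have [/ac ->|h] := hd w; first by rewrite !mul0r.
rewrite ler_wpM2l ?(law_ge0 sq) // mulr_natr -lnXn // ler_ln ?posrE ?exprn_gt0 //.
  by rewrite size_tuple in h.
by apply: lt_le_trans h; rewrite exprn_gt0.
Qed.

(** [fekete] is applied to the entropy, to the cross entropy plus ln K, and to their sum. The third
    application gives the last conclusion: if the rate of the sum is 0, so is its infimum, and every
    term is nonnegative. *)
Lemma entropy_rates (K d : R) : 1 <= K ->
  (forall u v, m (u ++ v) <= K * m u * m v) ->
  0 < d -> (forall w, m w = 0 \/ d ^+ size w <= m w) ->
  exists h u : R, [/\ (fun n => n%:R^-1 * Hlaw q n) @ \oo --> h,
    (fun n => n%:R^-1 * Hcross q m n) @ \oo --> u, h + u <= 0 &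
    h + u = 0 -> forall n, - ln K <= Hlaw q n + Hcross q m n].
Proof.
move=> K1 hK d0 hd.
have lK0 : 0 <= ln K by rewrite ln_ge0.
have Hge n : - (0 * n%:R) <= Hlaw q n by rewrite mul0r oppr0 Hlaw_ge0.
have [h ch _] := fekete (fun n1 n2 => Hlaw_subadd n1 n2 sq) Hge.
pose cr n := Hcross q m n + ln K.
have crs n1 n2 : cr (n1 + n2)%N <= cr n1 + cr n2.
  by have := Hcross_subadd n1 n2 K1 hK; rewrite /cr; lra.
have crge n : - (- ln d * n%:R) <= cr n.
  by apply: (le_trans (Hcross_ge n d0 hd)); rewrite lerDl.
have [u cu _] := fekete crs crge.
have inv0 (c : R) : (fun n => n%:R^-1 * c) @ \oo --> 0.
  rewrite -[X in _ --> X](mul0r c); apply: cvgMl.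
  apply/gtr0_cvgV0; last exact: cvgr_idn.
  by near=> n; rewrite ltr0n; near: n; apply: nbhs_infty_gt.
have cu' : (fun n => n%:R^-1 * Hcross q m n) @ \oo --> u.
  have -> : (fun n => n%:R^-1 * Hcross q m n) =
      (fun n => n%:R^-1 * cr n - n%:R^-1 * ln K).
    by apply/funext => n; rewrite -mulrBr addrK.
  by rewrite -[u]subr0; apply: cvgB cu (inv0 (ln K)).
pose b n := Hlaw q n + cr n.
have bs n1 n2 : b (n1 + n2)%N <= b n1 + b n2.
  by have := crs n1 n2; have := Hlaw_subadd n1 n2 sq; rewrite /b; lra.
have bge n : - (- ln d * n%:R) <= b n.
  by have := crge n; have := Hlaw_ge0 n sq; rewrite /b; lra.
have [L cL Lb] := fekete bs bge.
have LE : L = h + u.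
  apply: (cvg_unique _ cL); first exact: norm_hausdorff.
  have -> : (fun n => n%:R^-1 * b n) =
      (fun n => n%:R^-1 * Hlaw q n + n%:R^-1 * cr n).
    by apply/funext => n; rewrite -mulrDr.
  exact: cvgD ch cu.
exists h, u; split => //.
  have chu : (fun n => n%:R^-1 * (Hlaw q n + Hcross q m n)) @ \oo --> h + u.
    under eq_fun do rewrite mulrDr.
    exact: cvgD ch cu'.
  rewrite -(cvg_lim (@norm_hausdorff _ _) chu); apply: limr_le; first exact: cvgP chu.
  by near=> n; rewrite mulr_ge0_le0 // ?invr_ge0 // HDcross_le0.
by move=> hu0 n; have := Lb n; rewrite LE hu0 mulr0 /b /cr; lra.
Unshelve. all: by end_near. Qed.

(** If q u and m u differ, the squared ergodic average of the centred indicator of u has mean at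
    least (q u - m u)^2 under q at every length, but arbitrarily small mean under m. Tilting m
    exponentially by this square shows that the divergence would exceed D. *)
Lemma law_eq_of_bounded_divergence (p : nat) (c D : R) : 0 < c ->
  (forall u v, c * m u * m v <= \sum_(w : p.-tuple A) m (u ++ w ++ v)) ->
  (forall n, - D <= Hlaw q n + Hcross q m n) -> forall u, q u = m u.
Proof.
move=> c0 mc hD u; apply/eqP; rewrite -subr_eq0 -sqrf_eq0.
rewrite eq_le sqr_ge0 andbT leNgt; apply/negP => dl0.
set dl := (q u - m u) ^+ 2 in dl0.
have D0 : 0 <= D by have := hD 0%N; have := HDcross_le0 0%N; lra.
(* The contradiction is t * dl <= D + t * dl / 4 with t * dl = 4 * (D + 1). As t is fixed before N,
   the length can be taken large enough for the moment under m to absorb the factor expR t. *)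
pose t := 4%:R * (D + 1) / dl.
have t0 : 0 < t by rewrite divr_gt0 // mulr_gt0 //; lra.
pose r := size u.
pose phi := ind_dev u (m u).
have mu01 : 0 <= m u <= 1 by rewrite law_ge0 // law_le1.
have phi1 w : `|phi w| <= 1 by exact: ind_dev_le1.
have phi0 : \sum_(w : r.-tuple A) m w * phi w = 0 by rewrite ind_dev_mean // subrr.
have e0 : 0 < dl / (4%:R * expR t) by rewrite divr_gt0 // mulr_gt0 // expR_gt0.
have [N N0 hN] := variance_small phi1 sm c0 mc phi0 e0.
have Nr : 0 < N%:R :> R by rewrite ltr0n.
pose W := (N + r).-tuple A.
pose a (w : W) := bsum phi r N w / N%:R.
have a1 (w : W) : a w ^+ 2 <= 1.
  rewrite -(real_normK (num_real _)) expr_le1 // /a normrM normfV normr_nat.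
  by rewrite ler_pdivrMr // mul1r bsum_bound.
have J : dl <= \sum_(w : W) q w * a w ^+ 2 by exact: ind_dev_sq.
have DV : t * \sum_(w : W) q w * a w ^+ 2 <=
    D + t * expR t * \sum_(w : W) m w * a w ^+ 2.
  apply: (@le_trans _ _ (\sum_(w : W) (- (- (q w * ln (q w)) + q w * ln (m w)) +
     t * expR t * (m w * a w ^+ 2) + (m w - q w)))).
    rewrite mulr_sumr; apply: ler_sum => w _.
    have [mw|mw] := eqVneq (m w) 0; first by rewrite mw (ac mw) !(mul0r,mulr0) oppr0; lra.
    have mw0 : 0 < m w by rewrite lt_neqAle eq_sym mw (law_ge0 sm).
    set g := t * a w ^+ 2.
    have g0 : 0 <= g by rewrite mulr_ge0 ?sqr_ge0 // ltW.
    have gt : g <= t by rewrite -[X in _ <= X]mulr1 /g ler_wpM2l // ltW.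
    have b0 : 0 < m w * expR g by rewrite mulr_gt0 ?expR_gt0.
    have := gibbs_ineq (law_ge0 sq w) (ltW b0).
    rewrite lnM ?posrE ?expR_gt0 // expRK => /(_ _)H.
    have {}H : - (q w * ln (q w)) <=
        - (q w * (ln (m w) + g)) + (m w * expR g - q w).
      by apply: H => e; rewrite e ltxx in b0.
    (* Since 0 <= g <= t, the exponential is bounded by an affine function of g, so only the second
       moment under m enters, not an exponential moment. *)
    have eg : expR g <= 1 + g * expR t.
      have e1 : expR g <= 1 + g * expR g.
        have := expR_ge1Dx (- g); rewrite expRN.
        rewrite -(ler_pM2r (expR_gt0 g)) mulVf ?gt_eqF ?expR_gt0 //; lra.
      apply: (le_trans e1); rewrite lerD2l ler_wpM2l // ler_expR //.
    have := ler_wpM2l (ltW mw0) eg.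
    have -> : t * expR t * (m w * a w ^+ 2) = m w * (g * expR t) by rewrite /g; ring.
    have -> : t * (q w * a w ^+ 2) = q w * g by rewrite /g; ring.
    by move: H; lra.
  rewrite big_split /= big_split /= [X in _ + X]sumrB !law_total // subrr addr0 -mulr_sumr lerD2r.
  rewrite sumrN big_split /= -/(Hlaw q (N + r)) -/(Hcross q m (N + r)).
  by have := hD (N + r)%N; lra.
have h1 : t * expR t * \sum_(w : W) m w * a w ^+ 2 <= t * (dl / 4%:R).
  rewrite -mulrA ler_pM2l // mulrC.
  have := ler_wpM2r (expR_ge0 t) hN => /le_trans; apply.
  rewrite invfM mulrA mulfVK // gt_eqF ?expR_gt0 //.
have h2 : t * (dl / 4%:R) = D + 1 by rewrite /t; field; rewrite gt_eqF.
have := ler_wpM2l (ltW t0) J.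
have h3 : t * dl = 4%:R * (D + 1) by rewrite -h2; field.
by lra.
Qed.

End Entropy.

(** * Laws of processes *)

Section Probability.
Context d (T : measurableType d) (R : realType) (P : probability T R).
Implicit Types E F : set T.

Definition pr E : R := fine (P E).

Lemma prE E : measurable E -> P E = (pr E)%:E.
Proof. by move=> mE; rewrite /pr fineK // fin_num_measure. Qed.

Lemma pr_ge0 E : 0 <= pr E.
Proof. by rewrite /pr fine_ge0. Qed.

Lemma pr0 : pr set0 = 0. Proof. by rewrite /pr measure0. Qed.

Lemma prT : pr setT = 1. Proof. by rewrite /pr probability_setT. Qed.

Lemma le_pr E F : measurable E -> measurable F -> E `<=` F -> pr E <= pr F.
Proof. by move=> mE mF EF; rewrite -lee_fin -!prE // le_measure ?inE. Qed.

Lemma pr_setU E F : measurable E -> measurable F -> E `&` F = set0 ->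
  pr (E `|` F) = pr E + pr F.
Proof.
move=> mE mF EF; apply: EFin_inj; rewrite EFinD -!prE ?measureU //.
exact: measurableU.
Qed.

Lemma pr_setU_le E F : measurable E -> measurable F ->
  pr (E `|` F) <= pr E + pr F.
Proof.
move=> mE mF; rewrite -lee_fin EFinD -!prE ?measureU2 //.
exact: measurableU.
Qed.

Lemma pr_setI E F : measurable E -> measurable F -> pr F = 1 -> pr (E `&` F) = pr E.
Proof.
move=> mE mF F1; apply/eqP; rewrite eq_le; apply/andP; split.
  by apply: le_pr => //; exact: measurableI.
have mC : measurable (~` F) by exact: measurableC.
have C0 : pr (~` F) = 0.
  by have := pr_setU mF mC (setICr F); rewrite setUv prT F1; lra.
have mI : measurable (E `&` F) by exact: measurableI.
rewrite -[X in _ <= X]addr0 -C0.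
apply: le_trans (pr_setU_le mI mC); apply: le_pr => //; first exact: measurableU.
by move=> x Ex; have [Fx|nFx] := pselect (F x); [left|right].
Qed.

Lemma pr_abs_le E F D : measurable E -> measurable F -> measurable D ->
  (forall x, ~ D x -> (E x <-> F x)) -> `|pr E - pr F| <= pr D.
Proof.
have h (E' F' D' : set T) : measurable E' -> measurable F' -> measurable D' ->
  (forall x, ~ D' x -> (E' x <-> F' x)) -> pr E' <= pr F' + pr D'.
  move=> mE mF mD H; apply: le_trans (pr_setU_le mF mD).
  apply: le_pr => //; first exact: measurableU.
  by move=> x Ex; have [Dx|/H[+ _]] := pselect (D' x); [right|left; auto].
move=> mE mF mD H; rewrite ler_distl lerBlDr !h //.
by move=> x /H[? ?]; split.
Qed.

Variables (B : finType) (g : T -> B).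
Hypothesis mg : forall b, measurable (g @^-1` [set b]).

Lemma measurable_label (S : set B) : measurable (g @^-1` S).
Proof.
rewrite (_ : g @^-1` S = \bigcup_(b in S) (g @^-1` [set b])); last first.
  by apply/seteqP; split => [x Sx|x [b Sb /= ->]] //; exists (g x).
exact: fin_bigcup_measurable.
Qed.

Lemma pr_finsum E : measurable E ->
  pr E = \sum_b pr (E `&` g @^-1` [set b]).
Proof.
move=> mE.
have H (s : seq B) : uniq s ->
    pr (E `&` g @^-1` [set` s]) = \sum_(b <- s) pr (E `&` g @^-1` [set b]).
  elim: s => [_|b s IH /= /andP[bs us]].
    by rewrite big_nil -pr0; congr pr; apply/seteqP; split => x // [_].
  rewrite big_cons -IH // -pr_setU.
  - congr pr; rewrite -setIUr; congr (_ `&` _).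
    apply/seteqP; split => x /=; rewrite inE.
      by move=> /orP[/eqP|]; [left|right].
    by move=> [->|->]; rewrite ?eqxx ?orbT.
  - by apply: measurableI => //; exact: measurable_label.
  - by apply: measurableI => //; exact: measurable_label.
  - apply/seteqP; split => x //= -[[_ gx] [_]].
    by rewrite gx (negPf bs).
rewrite -H ?index_enum_uniq //; congr pr.
by apply/seteqP; split => [x Ex|x []//]; split=> //=; rewrite mem_index_enum.
Qed.

Lemma pr_label (e : pred B) :
  pr [set x | e (g x)] = \sum_b pr (g @^-1` [set b]) * (e b)%:R.
Proof.
rewrite (pr_finsum (measurable_label [set b | e b])); apply: eq_bigr => b _.
case eb : (e b); rewrite ?mulr1 ?mulr0.
  by congr pr; apply/seteqP; split => [x []//|x gx]; split => //=; rewrite gx.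
by rewrite -pr0; congr pr; apply/seteqP; split => [x [] /= + gx|//]; rewrite gx eb.
Qed.

End Probability.

Lemma measurable_label_pair d (T : measurableType d) (B C : finType)
    (g : T -> B) (h : T -> C) :
  (forall b, measurable (g @^-1` [set b])) ->
  (forall c, measurable (h @^-1` [set c])) ->
  forall bc, measurable ((fun x => (g x, h x)) @^-1` [set bc]).
Proof.
move=> mg mh [b c].
rewrite (_ : _ @^-1` _ = g @^-1` [set b] `&` h @^-1` [set c]); first exact: measurableI.
by apply/seteqP; split => x /=; [move=> [-> ->]|move=> [-> ->]].
Qed.

Section ProcessLaw.
Context d (T : measurableType d) (R : realType) (P : probability T R).
Variables (tr : T -> T) (mtr : measurable_fun setT tr).
Hypothesis tr_inv : forall E, measurable E -> P (tr @^-1` E) = P E.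
Variables (A : finType).
Implicit Types (g : T -> A) (w : seq A).

Definition itinerary g n x : seq A := mkseq (fun j => g (iter j tr x)) n.

(** The itinerary as a map into a finite type, to which the lemmas on finite labels apply. *)
Definition itinerary_tuple g n x : n.-tuple A := Tuple (introT eqP (size_mkseq (fun j => g (iter j tr x)) n)).

Definition process_law g w : R := pr P [set x | itinerary g (size w) x = w].

Lemma measurable_preimage_tr E : measurable E -> measurable (tr @^-1` E).
Proof. by move=> mE; rewrite -[X in measurable X]setTI; exact: mtr. Qed.

Lemma measurable_preimage_iter n E : measurable E -> measurable (iter n tr @^-1` E).
Proof. by elim: n E => //= n IH E mE; apply: IH (measurable_preimage_tr mE). Qed.

Lemma pr_iter n E : measurable E -> pr P (iter n tr @^-1` E) = pr P E.
Proof.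
elim: n E => //= n IH E mE.
rewrite -[RHS](_ : pr P (tr @^-1` E) = _); last by rewrite /pr tr_inv.
exact: IH (measurable_preimage_tr mE).
Qed.

Lemma itinerary_cons g n x : itinerary g n.+1 x = g x :: itinerary g n (tr x).
Proof.
rewrite /itinerary /mkseq /=; congr (_ :: _); rewrite (iotaDl 1 0) -map_comp.
by apply: eq_map => j /=; rewrite -iterSr.
Qed.

Lemma take_itinerary g n m x : (n <= m)%N ->
  take n (itinerary g m x) = itinerary g n x.
Proof. by move=> nm; rewrite /itinerary /mkseq -map_take take_iota (minn_idPl nm). Qed.

Lemma drop_itinerary g j n x :
  drop j (itinerary g (j + n) x) = itinerary g n (iter j tr x).
Proof.
elim: j x => [|j IH] x; first by rewrite drop0.
by rewrite addSn itinerary_cons /= IH -iterSr.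
Qed.

Variables (g : T -> A) (mg : forall a, measurable (g @^-1` [set a])).

Lemma measurable_itinerary w : measurable [set x | itinerary g (size w) x = w].
Proof.
elim: w => [|a w IH].
  by rewrite (_ : [set _ | _] = setT) //; apply/seteqP; split.
rewrite (_ : [set _ | _] = g @^-1` [set a] `&` tr @^-1` [set x | itinerary g (size w) x = w]).
  by apply: measurableI => //; exact: measurable_preimage_tr.
apply/seteqP; split => x; rewrite /= itinerary_cons; first by move=> [-> ->].
by move=> [-> ->].
Qed.

Lemma preimage_itinerary_tuple n (w : n.-tuple A) :
  itinerary_tuple g n @^-1` [set w] = [set x | itinerary g (size w) x = w].
Proof.
apply/seteqP; split => x /=; rewrite size_tuple; first by move=> <-.
by move=> e; apply/val_inj.
Qed.

Lemma measurable_itinerary_tuple n (w : n.-tuple A) :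
  measurable (itinerary_tuple g n @^-1` [set w]).
Proof. by rewrite preimage_itinerary_tuple; exact: measurable_itinerary. Qed.

Lemma process_law_tuple n (w : n.-tuple A) :
  process_law g w = pr P (itinerary_tuple g n @^-1` [set w]).
Proof. by rewrite preimage_itinerary_tuple. Qed.

Lemma process_law_stationary : stationary_law (process_law g).
Proof.
split.
- rewrite /process_law (_ : [set _ | _] = setT) ?prT //.
  by apply/seteqP; split.
- by move=> w; exact: pr_ge0.
- move=> w; have mw := measurable_itinerary w.
  rewrite -[RHS](pr_iter 1 mw) (pr_finsum P mg (measurable_preimage_iter 1 mw)).
  apply: eq_bigr => a _; congr pr.
  apply/seteqP; split => x; rewrite /= itinerary_cons; first by move=> [-> ->].
  by move=> [-> ->].
- move=> w; have mw := measurable_itinerary w.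
  have mgn a : measurable ((g \o iter (size w) tr) @^-1` [set a]).
    by rewrite comp_preimage; exact: measurable_preimage_iter.
  rewrite [RHS](pr_finsum P mgn mw); apply: eq_bigr => a _; congr pr.
  apply/seteqP; split => x; rewrite /= size_rcons /itinerary mkseqS.
    by move=> /rcons_inj[-> ->].
  by move=> [-> ->].
Qed.

End ProcessLaw.

(** * Comparing the entropies of two labels by coding *)

Section EntropyTransfer.
Variable R : realType.

(** H(I) <= H(J) + mean cost, where the hypothesis on S is Kraft's inequality given j: expR (- S) is
    a subprobability kernel from J to I. The proof compares p with q2 j * expR (- S (i, j)) by
    [gibbs_ineq] and bounds H(I) by the joint entropy, as p (i, j) <= q1 i. *)
Lemma entropy_transfer (I J : finType) (p S : I * J -> R) :
  (forall ij, 0 <= p ij) -> (forall j, \sum_i expR (- S (i, j)) <= 1) ->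
  \sum_i - ((\sum_j p (i, j)) * ln (\sum_j p (i, j))) <=
  \sum_j - ((\sum_i p (i, j)) * ln (\sum_i p (i, j))) + \sum_ij p ij * S ij.
Proof.
move=> p0 hS.
pose q1 i := \sum_j p (i, j); pose q2 j := \sum_i p (i, j).
have pq1 i j : p (i, j) <= q1 i by rewrite /q1 (bigD1 j) //= lerDl sumr_ge0.
have pq2 i j : p (i, j) <= q2 j by rewrite /q2 (bigD1 i) //= lerDl sumr_ge0.
have q20 j : 0 <= q2 j by exact: sumr_ge0.
have -> : \sum_j - (q2 j * ln (q2 j)) = \sum_i \sum_j - (p (i, j) * ln (q2 j)).
  by rewrite exchange_big; apply: eq_bigr => j _; rewrite sumrN -mulr_suml.
have -> : \sum_i - (q1 i * ln (q1 i)) = \sum_i \sum_j - (p (i, j) * ln (q1 i)).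
  by apply: eq_bigr => i _; rewrite sumrN -mulr_suml.
have -> : \sum_ij p ij * S ij = \sum_i \sum_j p (i, j) * S (i, j).
  by rewrite pair_bigA /=; apply: eq_bigr => -[].
apply: (@le_trans _ _ (\sum_i \sum_j (- (p (i, j) * ln (q2 j)) + p (i, j) * S (i, j)
    + (q2 j * expR (- S (i, j)) - p (i, j))))).
  apply: ler_sum => i _; apply: ler_sum => j _.
  have [z|nz] := eqVneq (p (i, j)) 0.
    by have := mulr_ge0 (q20 j) (expR_ge0 (- S (i, j))); rewrite z; lra.
  have pp : 0 < p (i, j) by rewrite lt_neqAle eq_sym nz p0.
  have qp1 := lt_le_trans pp (pq1 i j); have qp2 := lt_le_trans pp (pq2 i j).
  have b0 : 0 < q2 j * expR (- S (i, j)) by rewrite mulr_gt0 ?expR_gt0.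
  have := gibbs_ineq (p0 (i, j)) (ltW b0); rewrite lnM ?posrE ?expR_gt0 // expRK.
  move=> H; have {}H := H (fun e => match (negP (negbT (lt_eqF b0)) (introT eqP (esym e))) with end).
  have : p (i, j) * ln (p (i, j)) <= p (i, j) * ln (q1 i).
    by rewrite ler_wpM2l // ler_ln ?posrE.
  by move: H; rewrite mulrDr; lra.
under eq_bigr => i _ do rewrite big_split big_split /=.
rewrite big_split big_split /= -[X in _ <= X]addr0 lerD2l.
under eq_bigr => i _ do rewrite sumrB.
rewrite sumrB subr_le0 exchange_big [X in _ <= X]exchange_big /=.
apply: ler_sum => j _; rewrite -mulr_sumr -/(q2 j).
by rewrite ler_piMr.
Qed.

(** Costs add along the word, so the Kraft sum factors into one-letter sums. *)
Lemma sum_exp_cost_le1 (A : finType) (cost : A -> A -> R) (a0 : A) n (c : nat -> A) :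
  (forall b, \sum_a expR (- cost a b) <= 1) ->
  \sum_(w : n.-tuple A) expR (- \sum_(0 <= j < n) cost (nth a0 w j) (c j)) <= 1.
Proof.
move=> hc; elim: n c => [|n IH] c.
  rewrite (big_tuple0 (fun w => expR (- \sum_(0 <= j < 0) cost (nth a0 w j) (c j)))).
  by rewrite big_geq // oppr0 expR0.
rewrite (big_tupleS n (fun w => expR (- \sum_(0 <= j < n.+1) cost (nth a0 w j) (c j)))).
apply: le_trans (hc (c 0%N)); apply: ler_sum => a _.
under eq_bigr => w _ do rewrite big_nat_recl //= opprD expRD.
by rewrite -mulr_sumr ler_piMr ?expR_ge0 // (IH (c \o S)).
Qed.

(** The weights are dominated by a probability: keep the predicted letter b with probability 1 - dl,
    otherwise draw a letter uniformly. *)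
Lemma hamming_cost (A : finType) (dl : R) (b : A) : 0 < dl -> dl < 1 ->
  \sum_a expR (- (- ln (1 - dl) + (a != b)%:R * (ln #|A|%:R - ln dl))) <= 1.
Proof.
move=> d0 d1.
have M0 : 0 < #|A|%:R :> R by rewrite ltr0n; apply/card_gt0P; exists b.
have d1' : 0 < 1 - dl by lra.
apply: (@le_trans _ _ (\sum_a ((a == b)%:R * (1 - dl) + dl / #|A|%:R))).
  apply: ler_sum => a _; case: eqP => _ /=.
    rewrite mul0r addr0 opprK lnK ?posrE // mul1r lerDl divr_ge0 // ltW //.
  rewrite !mul1r mul0r add0r opprD opprK expRD lnK ?posrE // opprB.
  rewrite -ln_div ?posrE // lnK ?posrE ?divr_gt0 // ler_piMl ?divr_ge0 ?ltW //; lra.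
rewrite big_split /= sumr_const -[X in _ + X]mulr_natr divfK ?gt_eqF //.
rewrite -mulr_suml (bigD1 b) //= eqxx big1 ?addr0 ?mul1r; last by move=> a /negPf ->.
by rewrite subrK.
Qed.

Context d (T : measurableType d) (P : probability T R).
Variables (tr : T -> T) (mtr : measurable_fun setT tr).
Hypothesis tr_inv : forall E, measurable E -> P (tr @^-1` E) = P E.

(* A label that is well approximated by a function of r consecutive values of
   another one costs little: code it from the approximation plus independent
   errors of probability dl. *)
Lemma entropy_approx (A B : finType) (xi : T -> A) (al : T -> B) (r : nat)
    (f : seq B -> A) (eta dl : R) :
  (forall a, measurable (xi @^-1` [set a])) ->
  (forall b, measurable (al @^-1` [set b])) ->
  pr P [set x | xi x != f (itinerary tr al r x)] <= eta -> 0 < dl -> dl < 1 ->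
  forall n, Hlaw (process_law P tr xi) n <= Hlaw (process_law P tr al) (n + r) +
    n%:R * (- ln (1 - dl) + eta * (ln #|A|%:R - ln dl)).
Proof.
move=> mxi mal heta d0 d1 n.
pose a0 := f [::].
have M1 : 1 <= #|A|%:R :> R by rewrite ler1n; apply/card_gt0P; exists a0.
set C1 := - ln (1 - dl); set C2 := ln #|A|%:R - ln dl.
have C20 : 0 <= C2 by rewrite subr_ge0 ler_ln ?posrE //; lra.
pose cost (a b : A) := C1 + (a != b)%:R * C2.
pose G x := (itinerary_tuple tr xi n x, itinerary_tuple tr al (n + r) x).
have mG : forall c, measurable (G @^-1` [set c]).
  by apply: measurable_label_pair; exact: measurable_itinerary_tuple.
pose p c := pr P (G @^-1` [set c]).
(* Total cost of the itinerary of xi against its prediction from that of al; predicting n symbols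
   reads at most n + r labels of al. *)
pose S (c : n.-tuple A * (n + r).-tuple B) :=
  \sum_(0 <= j < n) cost (nth a0 c.1 j) (f (take r (drop j c.2))).
have p0 c : 0 <= p c by exact: pr_ge0.
have hS (v : (n + r).-tuple B) : \sum_(w : n.-tuple A) expR (- S (w, v)) <= 1.
  apply: (@sum_exp_cost_le1 A cost a0 n (fun j => f (take r (drop j v)))).
  by move=> b; exact: hamming_cost.
have := entropy_transfer p0 hS.
have -> : \sum_(w : n.-tuple A) - ((\sum_(v : (n + r).-tuple B) p (w, v)) *
    ln (\sum_(v : (n + r).-tuple B) p (w, v))) = Hlaw (process_law P tr xi) n.
  apply: eq_bigr => w _.
  suff -> : \sum_(v : (n + r).-tuple B) p (w, v) = process_law P tr xi w by [].
  rewrite process_law_tuple.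
  rewrite (pr_finsum P (measurable_itinerary_tuple mtr mal (n := n + r)) (measurable_itinerary_tuple mtr mxi w)).
  apply: eq_bigr => v _; congr pr.
  by apply/seteqP; split => x; [case=> <- <-|case=> /= <- /= <-].
have -> : \sum_(v : (n + r).-tuple B) - ((\sum_(w : n.-tuple A) p (w, v)) *
    ln (\sum_(w : n.-tuple A) p (w, v))) = Hlaw (process_law P tr al) (n + r).
  apply: eq_bigr => v _.
  suff -> : \sum_(w : n.-tuple A) p (w, v) = process_law P tr al v by [].
  rewrite process_law_tuple.
  rewrite (pr_finsum P (measurable_itinerary_tuple mtr mxi (n := n)) (measurable_itinerary_tuple mtr mal v)).
  apply: eq_bigr => w _; congr pr.
  by apply/seteqP; split => x; [case=> <- <-|case=> /= <- /= <-].
move=> /le_trans; apply; rewrite lerD2l.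
have -> : \sum_c p c * S c = \sum_(0 <= j < n) (C1 * \sum_c p c +
    C2 * \sum_c p c * (nth a0 c.1 j != f (take r (drop j c.2)))%:R).
  under eq_bigr => c _ do rewrite /S mulr_sumr.
  rewrite exchange_big /=; apply: eq_bigr => j _.
  rewrite !mulr_sumr -big_split /=; apply: eq_bigr => c _.
  by rewrite /cost; ring.
have -> : \sum_c p c = 1.
  have := pr_label P mG predT; rewrite -[X in X = _](_ : 1 = _); last first.
    by rewrite -(prT P); congr pr; apply/seteqP; split.
  by move=> ->; apply: eq_bigr => c _; rewrite mulr1.
apply: (@le_trans _ _ (\sum_(0 <= j < n) (C1 + C2 * eta))); last first.
  by rewrite sumr_const_nat subn0 mulr_natl [eta * _]mulrC.
apply: ler_sum_nat => j /andP[_ jn]; rewrite mulr1 lerD2l ler_wpM2l //.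
rewrite -(pr_label P mG (fun c => nth a0 c.1 j != f (take r (drop j c.2)))).
have mE : measurable [set x | xi x != f (itinerary tr al r x)].
  have := measurable_label (measurable_label_pair mxi (measurable_itinerary_tuple mtr mal (n := r)))
    [set c : A * r.-tuple B | c.1 != f c.2].
  by [].
(* By invariance the prediction fails at position j with the same probability as at position 0. *)
apply: le_trans heta; rewrite -(pr_iter mtr tr_inv j mE) le_eqVlt; apply/orP; left.
apply/eqP; congr pr; apply/seteqP; split => x /=;
  rewrite nth_mkseq // (_ : mkseq _ _ = itinerary tr al (n + r) x) //;
  rewrite (_ : n + r = j + ((n - j) + r))%N ?drop_itinerary ?take_itinerary //; lia.
Qed.

End EntropyTransfer.

(** * Approximation by cylinders *)

Section Cylinders.
Variable k : nat.
Implicit Types (x : MT k) (w u v : seq 'I_k.+1).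

Lemma measurable_cylinder w : measurable ([set x | pref (size w) x = w] : set (MT k)).
Proof. by apply: sub_sigma_algebra; exists w. Qed.

Lemma prefS n (x : pts k) : pref n.+1 x = x 0%N :: pref n (sshift x).
Proof.
rewrite /pref /mkseq /=; congr (_ :: _); rewrite (iotaDl 1 0) -map_comp.
exact: eq_map.
Qed.

Lemma iter_sshift n (x : pts k) j : iter n sshift x j = x (n + j)%N.
Proof. by elim: n j => // n IH j; rewrite iterS /sshift IH addnS. Qed.

Lemma prefD n m (x : pts k) : pref (n + m) x = pref n x ++ pref m (iter n sshift x).
Proof.
by elim: n x => // n IH x; rewrite addSn !prefS IH cat_cons iterSr.
Qed.

Lemma size_pref n (x : pts k) : size (pref n x) = n.
Proof. exact: size_mkseq. Qed.

Lemma take_pref n m (x : pts k) : (n <= m)%N -> take n (pref m x) = pref n x.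
Proof. by move=> nm; rewrite /pref /mkseq -map_take take_iota (minn_idPl nm). Qed.

Lemma measurable_mshift : measurable_fun setT (@mshift k).
Proof.
apply: (@measurability _ _ _ _ setT (@mshift k) (@cylinders k)) => //.
move=> _ [_ [w _ <-] <-]; rewrite setTI.
rewrite (_ : _ @^-1` _ = \bigcup_(a in [set: 'I_k.+1])
    [set x : MT k | pref (size (a :: w)) x = a :: w]); last first.
  apply/seteqP; split => x; rewrite /= /mshift => h.
    by exists (x 0%N) => //=; rewrite prefS h.
  by case: h => a _ /=; rewrite prefS => -[].
by apply: fin_bigcup_measurable => // a _; exact: measurable_cylinder.
Qed.

Definition letter0 (x : MT k) : 'I_k.+1 := x 0%N.

Lemma measurable_letter0 a : measurable (letter0 @^-1` [set a]).
Proof.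
rewrite (_ : _ @^-1` _ = [set x : MT k | pref (size [:: a]) x = [:: a]]).
  exact: measurable_cylinder.
by apply/seteqP; split => x; rewrite /= /pref /mkseq /letter0 /=; [move=> ->|case].
Qed.

Lemma itinerary_letter0 n x : itinerary (@mshift k) letter0 n x = pref n x.
Proof. by elim: n x => // n IH x; rewrite itinerary_cons IH prefS. Qed.

Definition pref_tuple n x : n.-tuple 'I_k.+1 :=
  Tuple (introT eqP (size_pref n x)).

Lemma preimage_pref_tuple n (w : n.-tuple 'I_k.+1) :
  pref_tuple n @^-1` [set w] = [set x | pref (size w) x = w].
Proof.
apply/seteqP; split => x /=; rewrite size_tuple; first by move=> <-.
by move=> e; apply/val_inj.
Qed.

Lemma measurable_pref_tuple n (w : n.-tuple 'I_k.+1) :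
  measurable (pref_tuple n @^-1` [set w]).
Proof. by rewrite preimage_pref_tuple; exact: measurable_cylinder. Qed.

(** There are finitely many words of length n, so an arbitrary condition on the prefix cuts out a
    finite union of cylinders. *)
Lemma measurable_pref n (e : seq 'I_k.+1 -> Prop) :
  measurable ([set x | e (pref n x)] : set (MT k)).
Proof.
exact: (measurable_label (@measurable_pref_tuple n) [set w : n.-tuple 'I_k.+1 | e w]).
Qed.

End Cylinders.

Lemma pref_factor k l (p : 'I_k.+1 -> 'I_l.+1) n (x : pts k) :
  pref n (factor_map p x) = map p (pref n x).
Proof. by rewrite /pref /mkseq -map_comp. Qed.

Lemma measurable_factor_map k l (p : 'I_k.+1 -> 'I_l.+1) :
  measurable_fun setT (factor_map p : MT k -> MT l).
Proof.
apply: (@measurability _ _ (MT k) (MT l) setT _ (@cylinders l)) => //.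
move=> _ [_ [w _ <-] <-]; rewrite setTI.
have := @measurable_pref k (size w) (fun u => map p u = w).
by congr measurable; apply/seteqP; split => x /=; rewrite pref_factor.
Qed.

Section Approximation.
Variables (R : realType) (k : nat).
Implicit Types (P Q : probability (MT k) R) (E : set (MT k)).

(** Symmetric difference of E and a finite union of cylinders of length r. *)
Definition approx_error E r (e : pred (seq 'I_k.+1)) : set (MT k) :=
  [set x | `[<E x>] != e (pref r x)].

Lemma measurable_approx_error E r e : measurable E -> measurable (approx_error E r e).
Proof.
move=> mE.
have me := @measurable_pref k r (fun w => e w).
rewrite (_ : approx_error E r e = (E `&` ~` [set x | e (pref r x)]) `|`
   (~` E `&` [set x | e (pref r x)])).
  apply: measurableU; apply: measurableI => //; exact: measurableC.
apply/seteqP; split => x; rewrite /approx_error /=.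
  by have [Ex|nEx] := asboolP (E x); case: (e _) => // _; [left|right].
by move=> [[Ex /negP ne]|[nEx ee]]; [rewrite asboolT // eq_sym|rewrite asboolF // ee].
Qed.

Lemma notin_approx_error E r e x : ~ approx_error E r e x -> (E x <-> e (pref r x)).
Proof.
move=> nD; have <- : `[<E x>] = e (pref r x).
  by apply: contrapT => ne; apply: nD; apply/eqP.
by split => /asboolP.
Qed.

Lemma pr_approx P E r (e : pred (seq 'I_k.+1)) : measurable E ->
  `|pr P E - pr P [set x | e (pref r x)]| <= pr P (approx_error E r e).
Proof.
move=> mE; apply: pr_abs_le => //.
- exact: (@measurable_pref k r (fun w => e w)).
- exact: measurable_approx_error.
- exact: notin_approx_error.
Qed.

(** A single union of cylinders has to serve both measures, since [same_measure_of_word_law]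
    compares them on it. *)
Let approximable P Q E := measurable E /\ forall eps : R, 0 < eps ->
  exists r e, pr P (approx_error E r e) <= eps /\ pr Q (approx_error E r e) <= eps.

Let approximableU P Q E F :
  approximable P Q E -> approximable P Q F -> approximable P Q (E `|` F).
Proof.
move=> [mE aE] [mF aF]; split; first exact: measurableU.
move=> eps eps0; have e2 : 0 < eps / 2%:R by rewrite divr_gt0.
have [r [e [eP eQ]]] := aE _ e2; have [s [f [fP fQ]]] := aF _ e2.
exists (maxn r s), (fun w => e (take r w) || f (take s w)).
have h (M : probability (MT k) R) : pr M (approx_error E r e) <= eps / 2%:R ->
  pr M (approx_error F s f) <= eps / 2%:R ->
  pr M (approx_error (E `|` F) (maxn r s) (fun w => e (take r w) || f (take s w))) <= eps.
  move=> h1 h2; have mEr := measurable_approx_error r e mE.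
  have mFs := measurable_approx_error s f mF.
  apply: (@le_trans _ _ (pr M (approx_error E r e `|` approx_error F s f))); last first.
    by have := pr_setU_le M mEr mFs; lra.
  apply: le_pr; [|exact: measurableU|].
    by apply: measurable_approx_error; exact: measurableU.
  move=> x; rewrite /approx_error /= !take_pref ?leq_maxl ?leq_maxr // asbool_or.
  by do 2 case: asboolP => _; case: (e _) => /=; case: (f _) => //= _; by [left|right].
by split; apply: h.
Qed.

Lemma tail_small P (F : nat -> set (MT k)) eps : (forall n, measurable (F n)) ->
  nondecreasing_seq F -> 0 < eps ->
  \forall n \near \oo, pr P (\bigcup_i F i `\` F n) <= eps.
Proof.
move=> mF ndF eps0.
have mU : measurable (\bigcup_i F i) by exact: bigcupT_measurable.
have : P (F n) @[n --> \oo] --> (pr P (\bigcup_i F i))%:E.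
  by rewrite -prE //; exact: nondecreasing_cvg_mu.
move=> /fine_cvg /cvgrPdist_le /(_ _ eps0) h.
near=> n.
have : `|pr P (\bigcup_i F i) - pr P (F n)| <= eps by near: n.
have -> : pr P (\bigcup_i F i) = pr P (\bigcup_i F i `\` F n) + pr P (F n).
  rewrite -pr_setU //; [|exact: measurableD|by rewrite setDKI].
  by rewrite setUC setDUK //; exact: bigcup_sup.
by rewrite addrK; apply: le_trans; exact: ler_norm.
Unshelve. all: by end_near. Qed.

(** The approximable sets contain the cylinders and form a sigma-algebra. A countable union is first
    replaced by a finite one, by continuity from below for both measures. *)
Lemma measurable_approx P Q E : measurable E -> forall eps : R, 0 < eps ->
  exists r e, pr P (approx_error E r e) <= eps /\ pr Q (approx_error E r e) <= eps.
Proof.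
move=> mE; suff [] : approximable P Q E by [].
have triv F r (e : pred (seq 'I_k.+1)) eps : 0 < eps :> R ->
    (forall x, e (pref r x) = `[<F x>]) ->
    pr P (approx_error F r e) <= eps /\ pr Q (approx_error F r e) <= eps.
  move=> e0 h; rewrite (_ : approx_error F r e = set0) ?pr0 ?ltW //.
  by apply/seteqP; split => x //; rewrite /approx_error /= h eqxx.
apply: (@smallest_sub _ (sigma_algebra setT) (@cylinders k) (approximable P Q)) => //.
  split.
  - split => // eps e0; exists 0%N, (fun=> false); apply: triv => // x.
    by rewrite asboolF.
  - move=> F [mF aF]; rewrite setTD; split; first exact: measurableC.
    move=> eps /aF[r [e he]]; exists r, (fun w => ~~ e w).
    rewrite (_ : approx_error (~` F) r _ = approx_error F r e) //.
    apply/seteqP; split => x; rewrite /approx_error /= asbool_neg;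
      by case: `[<_>]; case: (e _).
  - move=> F' hF'; pose F : nat -> set (MT k) := F'.
    have hF n : approximable P Q (F n) by exact: hF'.
    suff : approximable P Q (\bigcup_i F i) by [].
    have mF n : measurable (F n) by case: (hF n).
    split; first exact: bigcupT_measurable.
    move=> eps e0; have e2 : 0 < eps / 2%:R by rewrite divr_gt0.
    pose G n := \big[setU/set0]_(i < n.+1) F i.
    have aG n : approximable P Q (G n).
      rewrite /G; elim: n => [|n IH]; first by rewrite big_ord_recl big_ord0 setU0.
      by rewrite big_ord_recr /=; exact: approximableU.
    have mG n : measurable (G n) by case: (aG n).
    have ndG : nondecreasing_seq G.
      by move=> a b ab; apply/subsetPset; apply: subset_bigsetU; rewrite ltnS.
    rewrite -(bigcup_bigsetU_bigcup F) -/(G).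
    have [N [tP tQ]] : exists N, pr P (\bigcup_i G i `\` G N) <= eps / 2%:R /\
        pr Q (\bigcup_i G i `\` G N) <= eps / 2%:R.
      have [N _ hN] := filterI (tail_small P mG ndG e2) (tail_small Q mG ndG e2).
      by exists N; have [] := hN N (leqnn N).
    have [r [e [eP eQ]]] := (aG N).2 _ e2.
    exists r, e.
    have mU : measurable (\bigcup_i G i) by exact: bigcupT_measurable.
    have h (M : probability (MT k) R) : pr M (\bigcup_i G i `\` G N) <= eps / 2%:R ->
      pr M (approx_error (G N) r e) <= eps / 2%:R ->
      pr M (approx_error (\bigcup_i G i) r e) <= eps.
      move=> h1 h2.
      have mD : measurable (\bigcup_i G i `\` G N) by exact: measurableD.
      have mA := measurable_approx_error r e (mG N).
      apply: (@le_trans _ _ (pr M ((\bigcup_i G i `\` G N) `|` approx_error (G N) r e))).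
        apply: le_pr; [exact: measurable_approx_error|exact: measurableU|].
        move=> x hx; have [Gx|nGx] := pselect (G N x).
          right; move: hx; rewrite /approx_error /= !asboolT //; by exists N.
        have [Ux|nUx] := pselect ((\bigcup_i G i) x); first by left.
        by right; move: hx; rewrite /approx_error /= !asboolF.
      by have := pr_setU_le M mD mA; lra.
    by split; apply: h.
move=> _ [w _ <-]; split; first exact: measurable_cylinder.
move=> eps e0; exists (size w), (fun u => u == w); apply: triv => // x /=.
by apply/eqP/asboolP.
Qed.

Definition word_law P (w : seq 'I_k.+1) : R := pr P [set x | pref (size w) x = w].

Lemma word_lawE P : word_law P = process_law P (@mshift k) (@letter0 k).
Proof.
apply/funext => w; congr pr; apply/seteqP; split => x /=;
  by rewrite itinerary_letter0.
Qed.

Lemma pr_pref P n (e : pred (seq 'I_k.+1)) :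
  pr P [set x | e (pref n x)] = \sum_(w : n.-tuple 'I_k.+1) word_law P w * (e w)%:R.
Proof.
rewrite (pr_label P (@measurable_pref_tuple k n) (fun w => e w)).
by apply: eq_bigr => w _; rewrite preimage_pref_tuple.
Qed.

Lemma same_measure_of_word_law P Q : word_law P =1 word_law Q -> same_measure P Q.
Proof.
move=> PQ E mE; rewrite !prE //; congr EFin; apply/eqP; rewrite -subr_eq0 -normr_le0.
apply/ler_addgt0Pr => eps e0; rewrite add0r.
have e2 : 0 < eps / 2%:R by rewrite divr_gt0.
have [r [e [eP eQ]]] := measurable_approx P Q mE e2.
have := pr_approx Q r e mE; have := pr_approx P r e mE; rewrite !pr_pref.
under eq_bigr => w _ do rewrite PQ.
set s := (\sum_(w : _) _) => hP hQ.
have := ler_normB (pr P E - s) (pr Q E - s).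
by rewrite opprB addrA subrK; move: hP hQ eP eQ; lra.
Qed.

End Approximation.

(** * Mixing *)

Section Mixing.
Variables (R : realType) (k : nat) (P : probability (MT k) R).
Hypothesis Pinv : forall E : set (MT k), measurable E -> P (@mshift k @^-1` E) = P E.
Local Notation A := 'I_k.+1.
Local Notation m := (word_law P).
Implicit Types (x : MT k).

Lemma word_law_stationary : stationary_law m.
Proof.
rewrite word_lawE; apply: process_law_stationary => //.
- exact: measurable_mshift.
- exact: measurable_letter0.
Qed.

Let sm := word_law_stationary.

(** Its itinerary reads x and its n-th shift side by side, so mixing becomes convergence, as n
    grows, of the probability of each fixed word of pairs. *)
Definition pair_label n x : A * A := (letter0 x, letter0 (iter n (@mshift k) x)).

Lemma measurable_pair_label n c : measurable (pair_label n @^-1` [set c]).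
Proof.
apply: (measurable_label_pair (@measurable_letter0 k)) => a.
exact: measurable_preimage_iter (@measurable_mshift k) n _ (measurable_letter0 a).
Qed.

Definition pair_law n := process_law P (@mshift k) (pair_label n).

Lemma pair_law_stationary n : stationary_law (pair_law n).
Proof.
apply: process_law_stationary => //; first exact: measurable_mshift.
exact: measurable_pair_label.
Qed.

Lemma itinerary_pair_label n s x :
  itinerary (@mshift k) (pair_label n) s x =
  zip (pref s x) (pref s (iter n (@mshift k) x)).
Proof.
elim: s x => // s IH x; rewrite itinerary_cons IH !prefS /=; congr (_ :: zip _ (pref _ _)).
by rewrite -iterSr.
Qed.

Lemma pair_lawE n (w : seq (A * A)) : pair_law n w =
  pr P [set x | pref (size w) x = unzip1 w /\
                pref (size w) (iter n (@mshift k) x) = unzip2 w].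
Proof.
congr pr; apply/seteqP; split => x; rewrite /= itinerary_pair_label.
  move=> <-; rewrite unzip1_zip ?unzip2_zip ?size_pref // size_zip !size_pref.
  by rewrite minnn.
by move=> [-> ->]; rewrite zip_unzip.
Qed.

Variables (K : R).
Hypothesis (K0 : 0 < K) (mK : forall u v, m (u ++ v) <= K * m u * m v).

(** When |w| <= n the two component words occupy disjoint windows, separated by n - |w| letters.
    Apply the quasi-Bernoulli bound after the first word, then sum over the letters in between. *)
Lemma pair_law_le n (w : seq (A * A)) : (size w <= n)%N ->
  pair_law n w <= K * (m (unzip1 w) * m (unzip2 w)).
Proof.
move=> wn; rewrite pair_lawE.
set s := size w in wn *; pose d := (n - s)%N.
have nE : n = (s + d)%N by rewrite /d; lia.
set u := unzip1 w; set v := unzip2 w.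
have su : size u = s by rewrite size_map.
have sv : size v = s by rewrite size_map.
have mE : measurable ([set x | pref s x = u /\ pref s (iter n (@mshift k) x) = v] : set (MT k)).
  have h := @measurable_pref k (n + s) (fun t => take s t = u /\ drop n t = v).
  rewrite (_ : [set _ | _] = [set x | take s (pref (n + s) x) = u /\ drop n (pref (n + s) x) = v]) //.
  apply/seteqP; split => x /=; rewrite take_pref ?leq_addl // prefD drop_size_cat ?size_pref //.
have mg (t : d.-tuple A) : measurable ((@pref_tuple k d \o iter s (@mshift k)) @^-1` [set t]).
  rewrite comp_preimage; apply: (measurable_preimage_iter (@measurable_mshift k)).
  exact: measurable_pref_tuple.
rewrite (pr_finsum P mg mE).
apply: (@le_trans _ _ (\sum_(t : d.-tuple A) K * (m u * m (t ++ v)))); last first.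
  by rewrite -!mulr_sumr (law_prefix sm).
apply: ler_sum => t _.
rewrite mulrA; apply: le_trans (mK u (t ++ v)).
rewrite le_eqVlt; apply/orP; left; apply/eqP; congr pr.
apply/seteqP; split => x /=; rewrite !size_cat su sv size_tuple.
  move=> [[xu xv] xt]; rewrite prefD xu; congr (_ ++ _).
  rewrite prefD -[pref d _]/(val (pref_tuple d (iter s (@mshift k) x))).
  by rewrite [pref_tuple _ _]xt -iterD addnC -nE; congr (_ ++ _).
rewrite prefD => /eqP; rewrite eqseq_cat ?size_pref ?su // => /andP[/eqP xu].
rewrite prefD eqseq_cat ?size_pref ?size_tuple // => /andP[/eqP xt /eqP xv].
split; last exact/val_inj.
by split=> //; rewrite nE addnC iterD.
Qed.

Variables (c : R) (p : nat).
Hypothesis (c0 : 0 < c)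
  (mc : forall u v, c * m u * m v <= \sum_(w : p.-tuple A) m (u ++ w ++ v)).

Definition product_law (w : seq (A * A)) : R := m (unzip1 w) * m (unzip2 w).

Lemma product_law_stationary : stationary_law product_law.
Proof.
case: (sm) => m1 m0 ml mr; split.
- by rewrite /product_law /= m1 mulr1.
- by move=> w; rewrite mulr_ge0.
- move=> w; rewrite /product_law -(ml (unzip1 w)) -(ml (unzip2 w)).
  rewrite big_distrlr /= pair_bigA /=; exact: eq_bigr.
- move=> w; rewrite /product_law -(mr (unzip1 w)) -(mr (unzip2 w)).
  rewrite big_distrlr /= pair_bigA /=; apply: eq_bigr => -[a b] _.
  by rewrite /unzip1 /unzip2 !map_rcons.
Qed.

(** The gap has the same length p in both coordinates, so the two sums over gap words multiply to
    one sum over words of pairs, and the constant is squared. *)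
Lemma product_law_transitive u v : c ^+ 2 * product_law u * product_law v <=
  \sum_(w : p.-tuple (A * A)) product_law (u ++ w ++ v).
Proof.
rewrite /product_law /unzip1 /unzip2.
under eq_bigr => w _ do rewrite !map_cat.
rewrite (big_tuple_unzip p (fun w1 w2 => m ([seq i.1 | i <- u] ++ w1 ++ [seq i.1 | i <- v]) *
   m ([seq i.2 | i <- u] ++ w2 ++ [seq i.2 | i <- v]))).
rewrite -big_distrlr /=; have m0 := law_ge0 sm.
apply: le_trans (ler_pM _ _ (mc (map fst u) (map fst v)) (mc (map snd u) (map snd v))).
- by rewrite le_eqVlt; apply/orP; left; apply/eqP; rewrite /unzip1 /unzip2; ring.
- by rewrite !mulr_ge0 // ltW.
- by rewrite !mulr_ge0 // ltW.
Qed.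

(* For large n the law of the pairs (x_j, x_{n+j}) is dominated up to the factor
   K by the product law, for which the ergodic averages have small variance. *)
Lemma pair_law_cvg w : (fun n => pair_law n w) @ \oo --> product_law w.
Proof.
apply/cvgrPdist_le => eps e0.
have sp := product_law_stationary.
have w01 : 0 <= product_law w <= 1 by rewrite (law_ge0 sp) (law_le1 sp).
have phi0 : \sum_(u : (size w).-tuple (A * A))
    product_law u * ind_dev w (product_law w) u = 0 by rewrite ind_dev_mean // subrr.
(* The domination costs a factor K, and the second moment controls the square of the deviation. *)
have d0 : 0 < eps ^+ 2 / K by rewrite divr_gt0 // exprn_gt0.
have [N N0 hN] := variance_small (fun u => ind_dev_le1 w u w01) sp
  (exprn_gt0 2 c0) product_law_transitive phi0 d0.
near=> n; rewrite distrC.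
have nN : (N + size w <= n)%N by near: n; apply: nbhs_infty_ge.
rewrite -ler_sqr ?nnegrE ?normr_ge0 ?(ltW e0) // real_normK ?num_real //.
apply: le_trans (ind_dev_sq w (product_law w) (pair_law_stationary n) N0) _.
apply: (@le_trans _ _ (K * (eps ^+ 2 / K))); last by rewrite mulrC divfK ?gt_eqF.
apply: le_trans (ler_wpM2l (ltW K0) hN); rewrite mulr_sumr; apply: ler_sum => u _.
rewrite [X in _ <= X]mulrA ler_wpM2r ?sqr_ge0 //.
by apply: pair_law_le; rewrite size_tuple.
Unshelve. all: by end_near. Qed.

Lemma mixing_of_quasi_bernoulli : mixing P.
Proof.
move=> E F mE mF; apply/cvgrPdist_le => eps e0.
(* Two errors from approximating E and F in the joint event, two in the product, and one from the
   convergence for unions of cylinders. *)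
pose dl := eps / 5%:R; have dl0 : 0 < dl by rewrite divr_gt0.
have [rE [e [eE _]]] := measurable_approx P P mE dl0.
have [rF [f [fF _]]] := measurable_approx P P mF dl0.
pose r := maxn rE rF.
pose E' := [set x : MT k | e (pref rE x)]; pose F' := [set x : MT k | f (pref rF x)].
have mE' : measurable E' by exact: (@measurable_pref k rE (fun w => e w)).
have mF' : measurable F' by exact: (@measurable_pref k rF (fun w => f w)).
have mit n (G : set (MT k)) : measurable G -> measurable (iter n (@mshift k) @^-1` G).
  exact: measurable_preimage_iter (@measurable_mshift k) n G.
have mDE := measurable_approx_error rE e mE; have mDF := measurable_approx_error rF f mF.
have h1 n : `|pr P ((iter n (@mshift k) @^-1` E) `&` F) -
    pr P ((iter n (@mshift k) @^-1` E') `&` F')| <= dl + dl.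
  have mD := measurableU _ _ (mit n _ mDE) mDF.
  apply: (@le_trans _ _ _ _ _ (pr_abs_le (D := (iter n (@mshift k) @^-1` approx_error E rE e)
    `|` approx_error F rF f) _ _ _ _ _)).
  - by apply: measurableI => //; exact: mit.
  - by apply: measurableI => //; exact: mit.
  - exact: mD.
  - move=> x /not_orP[nDE nDF].
    have nF := notin_approx_error (nDF : ~ approx_error F rF f x).
    have nE := notin_approx_error
      (nDE : ~ approx_error E rE e (iter n (@mshift k) x)).
    by split => -[] /=; rewrite /E' /F' /= => /nE ? /nF ?.
  - apply: (le_trans (pr_setU_le P (mit n _ mDE) mDF)); apply: lerD => //.
    by rewrite (pr_iter (@measurable_mshift k) Pinv).
(* The shifted point is the second component of [pair_label], so E is read on [unzip2] and F on
   [unzip1]. *)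
have h2 n : pr P ((iter n (@mshift k) @^-1` E') `&` F') =
    \sum_(w : r.-tuple (A * A)) pair_law n w *
      (e (take rE (unzip2 w)) && f (take rF (unzip1 w)))%:R.
  have mg := measurable_itinerary_tuple (@measurable_mshift k) (measurable_pair_label n) (n := r).
  have := pr_label P mg (fun w => e (take rE (unzip2 w)) && f (take rF (unzip1 w))).
  under [X in _ = X -> _]eq_bigr => w _ do rewrite -process_law_tuple.
  move=> <-; congr pr; apply/seteqP; split => x;
    have := itinerary_pair_label n r x; rewrite /itinerary /= => ->;
    rewrite unzip1_zip ?unzip2_zip ?size_pref //;
    rewrite !take_pref ?leq_maxl ?leq_maxr //; first by move=> [-> ->].
  by move=> /andP.
have h3 : \sum_(w : r.-tuple (A * A)) product_law w *
      (e (take rE (unzip2 w)) && f (take rF (unzip1 w)))%:R = pr P E' * pr P F'.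
  rewrite (big_tuple_unzip r (fun u v => m u * m v * (e (take rE v) && f (take rF u))%:R)).
  have -> : pr P E' = \sum_(v : r.-tuple A) m v * (e (take rE v))%:R.
    rewrite -(pr_pref P r (fun v => e (take rE v))); congr pr.
    by apply/seteqP; split => x; rewrite /E' /= take_pref ?leq_maxl.
  have -> : pr P F' = \sum_(u : r.-tuple A) m u * (f (take rF u))%:R.
    rewrite -(pr_pref P r (fun v => f (take rF v))); congr pr.
    by apply/seteqP; split => x; rewrite /F' /= take_pref ?leq_maxr.
  rewrite mulrC big_distrlr /=; apply: eq_bigr => u _; apply: eq_bigr => v _.
  by rewrite andbC -mulnb natrM; ring.
have h4 : (fun n => pr P ((iter n (@mshift k) @^-1` E') `&` F')) @ \oo --> pr P E' * pr P F'.
  rewrite -h3; under eq_fun => n do rewrite h2.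
  apply: cvg_big => [|w _]; first exact: add_continuous.
  by apply: cvgMl; exact: pair_law_cvg.
have h5 : `|pr P E * pr P F - pr P E' * pr P F'| <= dl + dl.
  have -> : pr P E * pr P F - pr P E' * pr P F' =
     (pr P E - pr P E') * pr P F + pr P E' * (pr P F - pr P F') by ring.
  have le1 (G : set (MT k)) : measurable G -> pr P G <= 1.
    by move=> mG; rewrite -(prT P); exact: le_pr.
  apply: le_trans (ler_normD _ _) _; apply: lerD; rewrite normrM.
    rewrite -[X in _ <= X]mulr1; apply: ler_pM => //.
      exact: le_trans (pr_approx P rE e mE) eE.
    by rewrite ger0_norm ?pr_ge0 // le1.
  rewrite -[X in _ <= X]mul1r; apply: ler_pM => //.
    by rewrite ger0_norm ?pr_ge0 // le1.
  exact: le_trans (pr_approx P rF f mF) fF.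
move/cvgrPdist_le : h4 => /(_ _ dl0) h4.
near=> n; have h6 : `|pr P E' * pr P F' - pr P ((iter n (@mshift k) @^-1` E') `&` F')| <= dl.
  by near: n.
have := h1 n; rewrite -!/(pr P _) /= => {}h1.
rewrite (_ : eps = 5%:R * dl); last by rewrite /dl mulrC divfK.
by move: h1 h5 h6; rewrite !ler_distl => /andP[? ?] /andP[? ?] /andP[? ?]; lra.
Unshelve. all: by end_near. Qed.

End Mixing.

(** * Entropy of an invariant measure *)

Section MeasureEntropy.
Variables (R : realType) (k : nat) (P : probability (MT k) R).
Hypothesis Pinv : forall E : set (MT k), measurable E -> P (@mshift k @^-1` E) = P E.

Lemma pr_bigsetU_le (I : Type) (s : seq I) (D : I -> set (MT k)) :
  (forall i, measurable (D i)) ->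
  pr P (\big[setU/set0]_(i <- s) D i) <= \sum_(i <- s) pr P (D i).
Proof.
move=> mD; elim: s => [|i s IH]; first by rewrite !big_nil pr0.
rewrite !big_cons; apply: le_trans (pr_setU_le P (mD i) _) _.
  exact: bigsetU_measurable.
by rewrite lerD2l.
Qed.

Lemma bigsetI_ordP (T : Type) n (F : 'I_n -> set T) x :
  (\big[setI/setT]_(j < n) F j) x <-> forall j, F j x.
Proof.
elim: n F => [|n IH] F; first by rewrite big_ord0; split => // _ [].
rewrite big_ord_recl; split => [[h0 /IH h] j|h]; last by split; [|apply/IH].
by case: (unliftP ord0 j) => [j' ->|->].
Qed.

Lemma partition_label m (xi : 'I_m -> set (MT k)) : Defs.partition xi ->
  exists lab : MT k -> 'I_m, forall i, lab @^-1` [set i] = xi i.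
Proof.
move=> [mxi [dxi uxi]].
have ex x : exists i, xi i x.
  by have : [set: MT k] x by []; rewrite -uxi => -[i _ xii]; exists i.
exists (fun x => sval (cid (ex x))) => i; apply/seteqP; split => x /=.
  by move=> <-; case: cid.
case: cid => j /= xj xii; apply: contrapT => /eqP ji.
by have := dxi _ _ ji => /seteqP[/(_ x) + _]; apply.
Qed.

Lemma HjoinE m (xi : 'I_m -> set (MT k)) (lab : MT k -> 'I_m) n :
  (forall i, lab @^-1` [set i] = xi i) ->
  Hjoin P n xi = Hlaw (process_law P (@mshift k) lab) n.
Proof.
move=> hlab; apply: eq_bigr => w _.
rewrite -/(pr P (join_elt xi w)).
suff -> : pr P (join_elt xi w) = process_law P (@mshift k) lab w by [].
rewrite process_law_tuple; congr pr; apply/seteqP; split => x.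
  move=> /bigsetI_ordP h; apply/eq_from_tnth => j; rewrite (tnth_nth (lab x)) /=.
  rewrite nth_mkseq //; have := h j; rewrite -hlab //.
move=> <-; apply/bigsetI_ordP => j; rewrite -hlab /= (tnth_nth (lab x)) /=.
by rewrite nth_mkseq.
Qed.

Lemma Hlaw_rate (A : finType) (q : seq A -> R) : stationary_law q ->
  cvgn (fun n => n%:R^-1 * Hlaw q n).
Proof.
move=> sq.
have Hge n : - (0 * n%:R) <= Hlaw q n by rewrite mul0r oppr0 Hlaw_ge0.
have [h ch _] := fekete (fun n1 n2 => Hlaw_subadd n1 n2 sq) Hge.
exact: cvgP ch.
Qed.

(** Each atom is approximated up to eta divided by the number of atoms. Outside the union of the
    errors exactly one atom claims the prefix, so [pick] returns the true label; the default value
    can only be returned on that union. *)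
Lemma partition_approx m (lab : MT k -> 'I_m) (eta : R) :
  (forall i, measurable (lab @^-1` [set i])) -> 0 < eta ->
  exists r (f : seq 'I_k.+1 -> 'I_m), pr P [set x | lab x != f (pref r x)] <= eta.
Proof.
move=> mlab eta0.
have M0 : 0 < #|'I_m|%:R :> R.
  by rewrite ltr0n; apply/card_gt0P; exists (lab (fun=> ord0)).
have em0 : 0 < eta / #|'I_m|%:R by rewrite divr_gt0.
have /choice[re hre] : forall i, exists re : nat * pred (seq 'I_k.+1),
    pr P (approx_error (lab @^-1` [set i]) re.1 re.2) <= eta / #|'I_m|%:R.
  move=> i; have [r [e [h _]]] := measurable_approx P P (mlab i) em0.
  by exists (r, e).
pose r := \max_i (re i).1.
pose f w := odflt (lab (fun=> ord0)) [pick i | (re i).2 (take (re i).1 w)].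
exists r, f.
pose D i := approx_error (lab @^-1` [set i]) (re i).1 (re i).2.
have mD i : measurable (D i) by exact: measurable_approx_error.
apply: (@le_trans _ _ (pr P (\big[setU/set0]_(i <- index_enum 'I_m) D i))); last first.
  apply: (le_trans (pr_bigsetU_le _ mD)).
  apply: (@le_trans _ _ (\sum_(i < m) eta / #|'I_m|%:R)); first by apply: ler_sum => i _; exact: hre.
  by rewrite sumr_const -[X in X <= _]mulr_natr divfK // gt_eqF.
apply: le_pr.
- have := measurable_label (measurable_label_pair mlab (@measurable_pref_tuple k r))
    [set c : 'I_m * r.-tuple 'I_k.+1 | c.1 != f c.2].
  by [].
- exact: bigsetU_measurable.
move=> x /= nf; apply: contrapT => nD.
have hD i : (lab x = i) <-> (re i).2 (take (re i).1 (pref r x)).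
  rewrite take_pref; last by rewrite /r; exact: leq_bigmax.
  have nDi : ~ D i x.
    by move=> Di; apply: nD; rewrite -bigcup_seq; exists i => //=; rewrite mem_index_enum.
  exact: notin_approx_error nDi.
move/negP: nf; apply; rewrite /f; case: pickP => [i /hD ->|/(_ (lab x))] //=.
by move=> /negP; case; apply/hD.
Qed.

(** The letter partition is generating: any other finite partition is predicted by finitely many
    letters up to small error, so by [entropy_approx] its rate exceeds h by at most eps. *)
Lemma entropyE h : (fun n => n%:R^-1 * Hlaw (word_law P) n) @ \oo --> h ->
  entropy P = h%:E.
Proof.
move=> ch; have sm := word_law_stationary Pinv.
have mm := @measurable_mshift k.
apply/eqP; rewrite eq_le; apply/andP; split.
  apply: ge_ereal_sup => _ [[m xi] /= pxi <-]; rewrite lee_fin /hpart.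
  have [lab hlab] := partition_label pxi.
  under eq_fun do rewrite (HjoinE _ hlab).
  have mlab i : measurable (lab @^-1` [set i]) by rewrite hlab; case: pxi.
  have sl := process_law_stationary mm Pinv mlab.
  have cl := Hlaw_rate sl.
  apply/ler_addgt0Pr => eps e0.
  (* With this choice - ln (1 - dl) = eps / 2. The error bound eta is chosen afterwards, because the
     price C2 of one error depends on dl; dividing by C2 + 1 covers the case C2 = 0. *)
  pose dl := 1 - expR (- (eps / 2%:R)).
  have ex1 : expR (- (eps / 2%:R)) < 1 by rewrite expR_lt1 oppr_lt0 divr_gt0.
  have ex0 := expR_gt0 (- (eps / 2%:R)).
  have d0 : 0 < dl by rewrite subr_gt0.
  have d1 : dl < 1 by rewrite /dl; lra.
  set C2 := ln (#|'I_m|%:R : R) - ln dl.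
  have C20 : 0 <= C2.
    have M1 : 1 <= #|'I_m|%:R :> R.
      by rewrite ler1n; apply/card_gt0P; exists (lab (fun=> ord0)).
    by rewrite subr_ge0 ler_ln ?posrE //; lra.
  have et0 : 0 < eps / 2%:R / (C2 + 1) by rewrite !divr_gt0 //; lra.
  have [r [f hf]] := partition_approx mlab et0.
  have hf' : pr P [set x | lab x != f (itinerary (@mshift k) (@letter0 k) r x)] <=
      eps / 2%:R / (C2 + 1).
    by under eq_set => x do rewrite itinerary_letter0.
  have main n : Hlaw (process_law P (@mshift k) lab) n <=
      Hlaw (word_law P) n + Hlaw (word_law P) r + n%:R * eps.
    have := entropy_approx mm Pinv mlab (@measurable_letter0 k) hf' d0 d1 n.
    rewrite -word_lawE -/C2 => /le_trans; apply; apply: lerD.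
      exact: Hlaw_subadd.
    rewrite ler_wpM2l // /dl opprB addrCA subrr addr0 expRK opprK.
    have : eps / 2%:R / (C2 + 1) * C2 <= eps / 2%:R.
      by rewrite mulrAC ler_pdivrMr; [rewrite ler_pM2l ?divr_gt0 //; lra|lra].
    by lra.
  have cr : (fun n => n%:R^-1 * Hlaw (word_law P) n + n%:R^-1 * Hlaw (word_law P) r + eps)
      @ \oo --> h + 0 + eps.
    apply: cvgD; last exact: cvg_cst.
    apply: cvgD => //; rewrite -[X in _ --> X](mul0r (Hlaw (word_law P) r)).
    apply: cvgMl; apply/gtr0_cvgV0; last exact: cvgr_idn.
    by near=> n; rewrite ltr0n; near: n; apply: nbhs_infty_gt.
  rewrite -[h]addr0 -(cvg_lim (@norm_hausdorff _ _) cr).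
  apply: ler_lim => //; first exact: cvgP cr.
  near=> n; have n0 : 0 < n%:R :> R by rewrite ltr0n; near: n; apply: nbhs_infty_gt.
  have := ler_wpM2l (ltW (_ : 0 < n%:R^-1)) (main n).
  rewrite invr_gt0 => /(_ n0) /le_trans; apply.
  by rewrite !mulrDr mulrA mulVf ?mul1r // gt_eqF.
pose xi := fun i => @letter0 k @^-1` [set i].
have pxi : Defs.partition xi.
  split; first exact: measurable_letter0.
  split; last by apply/seteqP; split => x // _; exists (letter0 x).
  move=> i j ij; apply/seteqP; split => x // -[/= xi1 xj1].
  by move: ij; rewrite -xi1 -xj1 eqxx.
have <- : hpart P xi = h.
  rewrite /hpart; under eq_fun do rewrite (HjoinE (lab := @letter0 k)) // -word_lawE.
  exact: cvg_lim ch.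
by apply: ereal_sup_ubound; exists (existT _ k.+1 xi).
Unshelve. all: by end_near. Qed.

End MeasureEntropy.

(** * Metric and integrals on a subshift *)

Section Metric.
Variables (R : realType) (k : nat).
Implicit Types (x y : pts k).

Let has_ubound_dist x y :
  ubound [set (2%:R ^- i : R) | i in [set i : nat | x i != y i]] 1.
Proof. by move=> _ [i _ <-]; rewrite invf_le1 ?exprn_gt0 // exprn_ege1 // ler1n. Qed.

Lemma dist_ge x y i : x i <> y i -> 2%:R ^- i <= dist (R := R) x y.
Proof.
move=> /eqP xy; apply: ub_le_sup; first by exists 1; exact: has_ubound_dist.
by exists i.
Qed.

Lemma dist_le x y n : pref n x = pref n y -> dist (R := R) x y <= 2%:R ^- n.
Proof.
move=> xy; have [[i xyi]|no] := pselect (exists i, x i != y i).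
  apply: ge_sup; first by exists (2%:R ^- i), i.
  move=> _ [j xyj <-]; have nj : (n <= j)%N.
    rewrite leqNgt; apply/negP => jn; move/negP: xyj; apply; apply/eqP.
    by have := congr1 (fun s => nth ord0 s j) xy; rewrite !nth_mkseq.
  by rewrite lef_pV2 ?posrE ?exprn_gt0 // ler_eXn2l // ltr1n.
rewrite /dist (_ : [set _ | _ in _] = set0) ?sup0 ?invr_ge0 ?exprn_ge0 //.
by apply/seteqP; split => // z [i xyi _]; apply: no; exists i.
Qed.

Lemma pow2_small (d : R) : 0 < d -> exists n, 2%:R ^- n < d.
Proof.
move=> d0; exists (Num.truncn d^-1).+1.
rewrite invf_plt ?posrE ?exprn_gt0 //; apply: lt_le_trans (truncnS_gt _) _.
by rewrite -natrX ler_nat ltnW // ltn_expl.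
Qed.

End Metric.

Section Subshift.
Variables (R : realType) (k : nat) (X : set (pts k)).

(** A closed set is the intersection over n of the finite unions of cylinders of length n that meet
    it. *)
Lemma measurable_subshift : subshift (R := R) X -> measurable (X : set (MT k)).
Proof.
move=> [cX _].
rewrite (_ : X = \bigcap_n [set x | exists2 y, X y & pref n y = pref n x]).
  apply: bigcapT_measurable => n.
  exact: (@measurable_pref k n (fun w => exists2 y, X y & pref n y = w)).
apply/seteqP; split => [x Xx n _|x h]; first by exists x.
apply: cX => e e0; have [n ne] := pow2_small e0.
have [y Xy yx] := h n I; exists y => //.
by apply: le_lt_trans (dist_le R (esym yx)) ne.
Qed.

Hypothesis mX : measurable (X : set (MT k)).

Lemma measurable_continuous_on (f : pts k -> R) : continuous_on X f ->
  measurable_fun (X : set (MT k)) (f : MT k -> R).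
Proof.
move=> cf; apply: (measurability _ (measurable_realfun.RGenOInfty.measurableE R)) => //.
move=> _ [_ [a ->] <-].
(* The whole cylinder of w lies above level a. By continuity every point above this level has such a
   prefix. *)
pose Pa w := forall y, X y -> pref (size w) y = w -> a < f y.
rewrite (_ : _ `&` _ = (X : set (MT k)) `&` \bigcup_n [set x | Pa (pref n x)]).
  apply: measurableI => //; apply: bigcupT_measurable => n.
  exact: (@measurable_pref k n Pa).
apply/seteqP; split => x [Xx]; rewrite /= ?in_itv /= ?andbT.
  move=> ax; split => //; have fa : 0 < f x - a by rewrite subr_gt0.
  have [d d0 hd] := cf x Xx _ fa; have [n nd] := pow2_small d0.
  exists n => // y Xy; rewrite size_pref => yx.
  have := hd y Xy (le_lt_trans (dist_le R (esym yx)) nd).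
  by rewrite ltr_norml => /andP[_]; lra.
by move=> [n _ h]; split => //; apply: h; rewrite ?size_pref.
Qed.

Variable Q : probability (MT k) R.
Hypothesis QX : Q X = 1%E.

Lemma pr_cyl w : pr Q (cyl X w) = word_law Q w.
Proof.
rewrite /word_law -(pr_setI (P := Q) (measurable_cylinder w) mX); last by rewrite /pr QX.
by congr pr; apply/seteqP; split => x /= [].
Qed.

Lemma word_law_support w : word_law Q w != 0 -> exists2 x, X x & pref (size w) x = w.
Proof.
rewrite -pr_cyl => nz; apply: contrapT => h; move/eqP: nz; apply.
rewrite -(pr0 Q); congr pr; apply/seteqP; split => // x [Xx xw].
by apply: h; exists x.
Qed.

Lemma integral_word_function n (F : seq 'I_k.+1 -> R) :
  (\int[Q]_(x in (X : set (MT k))) (F (pref n x))%:E =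
   (\sum_(w : n.-tuple 'I_k.+1) word_law Q w * F w)%:E)%E.
Proof.
pose Ind (w : n.-tuple 'I_k.+1) (x : MT k) : R := \1_([set x | pref (size w) x = w]) x.
have mw (w : n.-tuple 'I_k.+1) := measurable_cylinder (w : seq 'I_k.+1).
have iI w : Q.-integrable (X : set (MT k)) (fun x => (Ind w x)%:E).
  by apply: (integrableS measurableT) => //; exact: integrable_indic.
transitivity (\int[Q]_(x in (X : set (MT k))) (\sum_(w : n.-tuple 'I_k.+1) (F w)%:E * (Ind w x)%:E))%E.
  apply: eq_integral => x _.
  under eq_bigr => w _ do rewrite -EFinM.
  rewrite sumEFin; congr EFin; rewrite (bigD1 (pref_tuple n x)) //= big1.
    rewrite addr0 /Ind indicE mem_set ?mulr1 //= size_pref //.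
  move=> w wx; rewrite /Ind indicE memNset ?mulr0 //= => xw.
  by move/eqP: wx; apply; apply/val_inj; rewrite /= -xw size_tuple.
rewrite integral_sum //; last by move=> w; exact: integrableZl.
rewrite -sumEFin; apply: eq_bigr => w _.
rewrite integralZl // integral_indic // EFinM muleC; congr (_ * _)%E.
transitivity ((pr Q ([set x | pref (size w) x = w] `&` X))%:E).
  by apply: prE; exact: measurableI.
by congr EFin; apply: pr_setI => //; rewrite /pr QX.
Qed.

(** Replaces the integral of ln (phi n), up to a bounded error, by a finite sum over words. Being
    close to a function of finitely many words also makes f bounded, hence integrable. *)
Lemma integral_near_word_function n (F : seq 'I_k.+1 -> R) (f : pts k -> R) (C : R) :
  measurable_fun (X : set (MT k)) (f : MT k -> R) ->
  (forall x, X x -> `|f x - F (pref n x)| <= C) ->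
  exists2 I : R, (\int[Q]_(x in (X : set (MT k))) (f x)%:E = I%:E)%E &
    `|I - \sum_(w : n.-tuple 'I_k.+1) word_law Q w * F w| <= C.
Proof.
move=> mf hf; set s := \sum_(w : _) _.
pose M := \sum_(w : n.-tuple 'I_k.+1) `|F w|.
have FM x : `|F (pref n x)| <= M.
  by rewrite /M (bigD1 (pref_tuple n x)) //= lerDl sumr_ge0.
have Qfin : (Q X < +oo)%E by rewrite QX ltry.
have iF (D : R) : Q.-integrable (X : set (MT k)) (fun x => (F (pref n x) + D)%:E).
  apply: (measurable_bounded_integrable (f := fun x : MT k => F (pref n x) + D)) => //.
    apply: (measurable_funS measurableT) => //.
    move=> _ B mB; rewrite setTI.
    exact: (@measurable_pref k n (fun w => B (F w + D))).
  exists (M + `|D|); split; first exact: num_real.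
  move=> y My x _ /=; apply: le_trans (ltW My).
  by apply: le_trans (ler_normD _ _) _; rewrite lerD2r.
have if_ : Q.-integrable (X : set (MT k)) (EFin \o (f : MT k -> R)).
  apply: measurable_bounded_integrable => //.
  exists (M + C); split; first exact: num_real.
  move=> y My x Xx /=; apply: le_trans (ltW My).
  rewrite -[f x](subrK (F (pref n x))) addrC.
  by apply: le_trans (ler_normD _ _) _; apply: lerD; [exact: FM|exact: hf].
have intF (D : R) : (\int[Q]_(x in (X : set (MT k))) (F (pref n x) + D)%:E = (s + D)%:E)%E.
  rewrite (integral_word_function n (fun w => F w + D)); congr EFin.
  under eq_bigr => w _ do rewrite mulrDr.
  rewrite big_split /= -mulr_suml; congr (_ + _).
  have := pr_pref Q n predT; under eq_bigr => w _ do rewrite mulr1.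
  by move=> <-; rewrite -[RHS]mul1r -(prT Q); congr (_ * _); congr pr; apply/seteqP; split.
have fin := integrable_fin_num mX if_.
exists (fine (\int[Q]_(x in (X : set (MT k))) (f x)%:E)); first by rewrite fineK.
rewrite ler_distl -!lee_fin fineK // -!intF; apply/andP; split.
  apply: le_integral => // x; rewrite inE => Xx; rewrite lee_fin.
  by have := hf x Xx; rewrite ler_distl => /andP[].
apply: le_integral => // x; rewrite inE => Xx; rewrite lee_fin.
by have := hf x Xx; rewrite ler_distl => /andP[].
Qed.

End Subshift.

(** * Pressure and equilibrium states *)

Section Pressure.
Variables (R : realType) (k : nat) (X : set (pts k)) (phi : nat -> pts k -> R).
Variables (P : probability (MT k) R) (pr0 C : R).
Local Notation m := (word_law P).
Hypothesis Pinv : forall E : set (MT k), measurable E -> P (@mshift k @^-1` E) = P E.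
Hypotheses (mX : measurable (X : set (MT k))) (PX : P X = 1%E) (C0 : 0 < C)
  (phi_le : forall x n, (0 < n)%N -> X x ->
     phi n x <= C * expR (n%:R * pr0) * m (pref n x))
  (phi_ge : forall x n, (0 < n)%N -> X x ->
     C^-1 * expR (n%:R * pr0) * m (pref n x) <= phi n x).

Let sm := word_law_stationary Pinv.

(** Points that are (n, e)-separated with e >= 2^-r have distinct prefixes of length n + r, so each
    word of length n is the prefix of at most (k + 1)^r of them. *)
Lemma separated_sum_le n r (e : R) (E : seq (pts k)) : (0 < n)%N ->
  2%:R ^- r <= e -> nsep X n e E ->
  \sum_(x <- E) phi n x <= C * expR (n%:R * pr0) * #|'I_k.+1|%:R ^+ r.
Proof.
move=> n0 re [uE [EX Esep]].
pose F (w : (n + r).-tuple 'I_k.+1) : R := C * expR (n%:R * pr0) * m (take n w).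
have F0 w : 0 <= F w by rewrite mulr_ge0 ?(law_ge0 sm) // mulr_ge0 ?expR_ge0 // ltW.
have inj : {in E &, injective (@pref_tuple k (n + r))}.
  move=> x y xE yE /(congr1 val) /= xy; apply: contrapT => /(Esep _ _ xE yE)[i i_n].
  apply/negP; rewrite -leNgt; apply: le_trans re; apply: dist_le.
  have h z : pref r (iter i sshift z) = take r (drop i (pref (n + r) z)).
    rewrite (_ : n + r = i + ((n - i) + r))%N; last by lia.
    by rewrite prefD drop_size_cat ?size_pref // take_pref // leq_addl.
  by rewrite !h xy.
apply: (@le_trans _ _ (\sum_(x <- E) F (pref_tuple (n + r) x))).
  rewrite big_seq [X in _ <= X]big_seq; apply: ler_sum => x xE.
  by rewrite /F /= take_pref ?leq_addr //; apply: phi_le => //; exact: EX.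
rewrite -(big_map (@pref_tuple k (n + r)) xpredT F) big_uniq ?map_inj_in_uniq //=.
apply: (@le_trans _ _ (\sum_(w : (n + r).-tuple 'I_k.+1) F w)).
  by rewrite [X in _ <= X](bigID (mem (map (@pref_tuple k (n + r)) E))) /= lerDl sumr_ge0.
rewrite -mulr_sumr ler_wpM2l //; first by rewrite mulr_ge0 ?expR_ge0 // ltW.
rewrite (big_tuple_cat n r (fun w => m (take n w))).
under eq_bigr => u _ do under eq_bigr => v _ do rewrite take_size_cat ?size_tuple //.
under eq_bigr => u _ do rewrite sumr_const -mulr_natr card_tuple natrX.
by rewrite -mulr_suml (law_total sm) mul1r.
Qed.

(** One point is taken in each cylinder of positive measure; distinct words differ at some i < n,
    and there the i-th shifts differ in their first letter, hence are at distance 1. *)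
Lemma separated_set_exists n (e : R) : (0 < n)%N -> e < 1 ->
  exists2 E, nsep X n e E & C^-1 * expR (n%:R * pr0) <= \sum_(x <- E) phi n x.
Proof.
move=> n0 e1.
have ex (w : n.-tuple 'I_k.+1) : exists x, m w != 0 -> X x /\ pref n x = w.
  have [z|/(word_law_support mX PX)[x Xx xw]] := eqVneq (m w) 0; first by exists (fun=> ord0).
  by exists x => _; split => //; rewrite -{1}(size_tuple w).
have /choice[c hc] := ex.
pose s := seq.filter (fun w : n.-tuple 'I_k.+1 => m w != 0) (enum {: n.-tuple 'I_k.+1}).
have hs w : w \in s -> X (c w) /\ pref n (c w) = w.
  by rewrite mem_filter => /andP[/hc].
exists (map c s).
  split.
    have us : uniq s by apply: filter_uniq; exact: enum_uniq.
    rewrite map_inj_in_uniq // => v w /hs[_ pv] /hs[_ pw] cvw.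
    by apply/val_inj; rewrite /= -pv -pw cvw.
  split; first by move=> _ /mapP[w /hs[Xc _] ->].
  move=> _ _ /mapP[v /hs[_ pv] ->] /mapP[w /hs[_ pw] ->] ne.
  have [i i_n vw] : exists2 i, (i < n)%N & c v i <> c w i.
    apply: contrapT => no; apply: ne; congr c; apply/val_inj; rewrite /= -pv -pw.
    apply: (@eq_from_nth _ ord0) => [|i]; rewrite !size_pref // => i_n.
    by rewrite !nth_mkseq //; apply: contrapT => ?; apply: no; exists i.
  exists i => //; apply: lt_le_trans e1 _.
  have := @dist_ge R k (iter i sshift (c v)) (iter i sshift (c w)) 0.
  by rewrite expr0 invr1 !iter_sshift addn0; apply.
rewrite big_map big_filter big_enum_cond /=.
apply: (@le_trans _ _ (\sum_(w : n.-tuple 'I_k.+1 | m w != 0)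
    C^-1 * expR (n%:R * pr0) * m w)).
  rewrite -mulr_sumr -[X in X <= _]mulr1 -(law_total sm n).
  rewrite [X in _ * X <= _](bigID (fun w : n.-tuple 'I_k.+1 => m w != 0)) /=.
  by rewrite [X in _ + X]big1 ?addr0 // => w /negPn/eqP.
apply: ler_sum => w /hc[Xc pc].
by have := phi_ge n0 Xc; rewrite pc.
Qed.

Lemma pressureE : pressure X phi = pr0%:E.
Proof.
rewrite /pressure.
set G := (fun e : R => _).
(* The growth rate is the same at every scale below 1, so the limit in e is that of a constant. *)
suff GE e : 0 < e -> e < 1 -> G e = pr0%:E.
  apply: cvg_lim => //; apply: cvg_near_cst; near=> e; apply: GE.
    by near: e; exact: nbhs_right_gt.
  by near: e; exact: nbhs_right_lt.
move=> e0 e1; rewrite /G.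
have [r re] := pow2_small e0.
pose M : R := #|'I_k.+1|%:R ^+ r.
have M1 : 1 <= M by rewrite exprn_ege1 // ler1n card_ord.
have M0 : 0 < M by apply: lt_le_trans M1.
pose S n : R := sup [set \sum_(x <- E) phi n x | E in nsep X n e].
have Sb n : (0 < n)%N ->
    C^-1 * expR (n%:R * pr0) <= S n /\ S n <= C * expR (n%:R * pr0) * M.
  move=> n0; have [E hE Eg] := separated_set_exists n0 e1.
  have ub : ubound [set \sum_(x <- E) phi n x | E in nsep X n e]
      (C * expR (n%:R * pr0) * M).
    by move=> _ [E' hE' <-]; exact: separated_sum_le (ltW re) hE'.
  split; last by apply: ge_sup => //; exists (\sum_(x <- E) phi n x), E.
  apply: (le_trans Eg); apply: ub_le_sup; last by exists E.
  by exists (C * expR (n%:R * pr0) * M).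
have cS : (fun n => n%:R^-1 * ln (S n)) @ \oo --> pr0.
  have inv0 (c : R) : (fun n => pr0 + n%:R^-1 * c) @ \oo --> pr0.
    rewrite -[X in _ --> X]addr0; apply: cvgD; first exact: cvg_cst.
    rewrite -[X in _ --> X](mul0r c); apply: cvgMl.
    apply/gtr0_cvgV0; last exact: cvgr_idn.
    by near=> n; rewrite ltr0n; near: n; apply: nbhs_infty_gt.
  apply: (squeeze_cvgr _ (inv0 (ln C^-1)) (inv0 (ln C + ln M))).
  near=> n; have n0 : (0 < n)%N by near: n; apply: nbhs_infty_gt.
  have nr : 0 < n%:R :> R by rewrite ltr0n.
  have [lo hi] := Sb n n0.
  have p1 : 0 < C^-1 * expR (n%:R * pr0) by rewrite mulr_gt0 ?invr_gt0 ?expR_gt0.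
  have S0 := lt_le_trans p1 lo.
  have p2 : 0 < C * expR (n%:R * pr0) by rewrite mulr_gt0 ?expR_gt0.
  have -> : pr0 = n%:R^-1 * (n%:R * pr0) by rewrite mulrA mulVf ?mul1r ?gt_eqF.
  rewrite -!mulrDr !ler_pM2l ?invr_gt0 //; apply/andP; split.
    by rewrite addrC -{1}[n%:R * pr0]expRK -lnM ?posrE ?invr_gt0 ?expR_gt0 // ler_ln.
  rewrite addrA [_ + ln C]addrC -{1}[n%:R * pr0]expRK -lnM ?posrE ?expR_gt0 //.
  by rewrite -lnM ?posrE // ler_ln ?posrE ?mulr_gt0 ?expR_gt0.
have cS' : (fun n : nat => (n%:R^-1 * ln (S n))%:E) @ \oo --> pr0%:E.
  by apply: cvg_EFin; [exact: nearW|exact: cS].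
rewrite is_cvg_limn_esupE; last exact: cvgP cS'.
exact: cvg_lim cS'.
Unshelve. all: by end_near. Qed.

End Pressure.

(** * Variational principle and uniqueness for a Gibbs measure *)

Section GibbsState.
Variables (R : realType) (k : nat) (X : set (pts k)) (phi : nat -> pts k -> R).
Variables (P : probability (MT k) R) (pr0 C : R).
Local Notation m := (word_law P).
Hypothesis Pinv : forall E : set (MT k), measurable E -> P (@mshift k @^-1` E) = P E.
Hypotheses (mX : measurable (X : set (MT k))) (PX : P X = 1%E) (C1 : 1 <= C)
  (pot : potential X phi)
  (m_gt0 : forall x n, X x -> 0 < m (pref n x))
  (phi_le : forall x n, (0 < n)%N -> X x ->
     phi n x <= C * expR (n%:R * pr0) * m (pref n x))
  (phi_ge : forall x n, (0 < n)%N -> X x ->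
     C^-1 * expR (n%:R * pr0) * m (pref n x) <= phi n x).
Variables (K c d : R) (p : nat).
Hypotheses (K1 : 1 <= K) (mK : forall u v, m (u ++ v) <= K * m u * m v)
  (c0 : 0 < c)
  (mc : forall u v, c * m u * m v <= \sum_(w : p.-tuple 'I_k.+1) m (u ++ w ++ v))
  (d0 : 0 < d) (md : forall w, m w = 0 \/ d ^+ size w <= m w).

Let sm := word_law_stationary Pinv.
Let C0 : 0 < C. Proof. by apply: lt_le_trans C1. Qed.

Lemma ln_phi_near x n : (0 < n)%N -> X x ->
  `|ln (phi n x) - (n%:R * pr0 + ln (m (pref n x)))| <= ln C.
Proof.
move=> n0 Xx; have mx := m_gt0 n Xx.
have phi0 : 0 < phi n x by exact: (pot n0).1.
have e0 := expR_gt0 (n%:R * pr0).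
rewrite -{1}[n%:R * pr0]expRK -lnM ?posrE // ler_distl.
rewrite -lnV ?posrE // -!lnM ?posrE ?mulr_gt0 ?invr_gt0 //.
rewrite !ler_ln ?posrE ?mulr_gt0 ?invr_gt0 // ![_ * _^-1]mulrC.
apply/andP; split; first by rewrite mulrA; exact: phi_ge.
by rewrite mulrC mulrA; exact: phi_le.
Qed.

Section OtherMeasure.
Variable Q : probability (MT k) R.
Hypotheses (Qinv : forall E : set (MT k), measurable E -> Q (@mshift k @^-1` E) = Q E)
  (QX : Q X = 1%E).
Local Notation q := (word_law Q).
Let sq := word_law_stationary Qinv.

(** P charges every cylinder that meets X, and Q charges no other. *)
Lemma gibbs_support w : m w = 0 -> q w = 0.
Proof.
move=> mw; apply/eqP/negPn/negP => /(word_law_support mX QX)[x Xx xw].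
by have := m_gt0 (size w) Xx; rewrite xw mw ltxx.
Qed.

(** s is minus the relative entropy rate of Q with respect to P: ln (phi n) is within ln C of n *
    pr0 + ln m on prefixes, and this error disappears after division by n. The last clause serves
    the case Q = P, where every divergence is 0. *)
Lemma free_energyE : exists s : R, [/\ free_energy X phi Q = (pr0 + s)%:E, s <= 0,
  s = 0 -> (forall n, - ln K <= Hlaw q n + Hcross q m n) &
  (forall n, Hlaw q n + Hcross q m n = 0) -> s = 0].
Proof.
have [h [u [ch cu hu0 hu]]] := entropy_rates sq sm gibbs_support K1 mK d0 md.
exists (h + u); split => //; last first.
  move=> z.
  have chu : (fun n => n%:R^-1 * Hlaw q n + n%:R^-1 * Hcross q m n) @ \oo --> h + u.
    exact: cvgD ch cu.
  rewrite -(cvg_lim (@norm_hausdorff _ _) chu).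
  under eq_fun do rewrite -mulrDr z mulr0.
  exact: lim_cst.
rewrite /free_energy (entropyE Qinv ch).
pose F n w : R := n%:R * pr0 + ln (m w).
have hI n : exists I : R, (0 < n)%N ->
    (\int[Q]_(x in (X : set (MT k))) (ln (phi n x))%:E = I%:E)%E /\
    `|I - (n%:R * pr0 + Hcross q m n)| <= ln C.
  (* The bounds on phi start at n = 1; the value at 0 is a placeholder that the limit does not
     see. *)
  have [->|n0] := posnP n; first by exists 0.
  have mphi : measurable_fun (X : set (MT k)) (fun x : MT k => ln (phi n x)).
    apply: (measurableT_comp (@measurable_realfun.measurable_ln R)).
    by apply: (measurable_continuous_on mX); case: (pot n0).
  have [I I1 I2] := integral_near_word_function (F := F n) mX QX mphi
    (fun x Xx => ln_phi_near n0 Xx).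
  exists I => _; split => //; move: I2; congr (`|I - _| <= _).
  rewrite /F; under eq_bigr => w _ do rewrite mulrDr.
  by rewrite big_split /= -mulr_suml (law_total sq) mul1r.
have /choice[I HI] := hI.
have cI : (fun n => n%:R^-1 * I n) @ \oo --> pr0 + u.
  have inv0 (b : R) : (fun n => pr0 + n%:R^-1 * Hcross q m n + n%:R^-1 * b) @ \oo --> pr0 + u.
    rewrite -[X in _ --> X]addr0; apply: cvgD.
      by apply: cvgD => //; exact: cvg_cst.
    rewrite -[X in _ --> X](mul0r b); apply: cvgMl.
    apply/gtr0_cvgV0; last exact: cvgr_idn.
    by near=> n; rewrite ltr0n; near: n; apply: nbhs_infty_gt.
  apply: (squeeze_cvgr _ (inv0 (- ln C)) (inv0 (ln C))).
  near=> n; have n0 : (0 < n)%N by near: n; apply: nbhs_infty_gt.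
  have nr : 0 < n%:R :> R by rewrite ltr0n.
  have [_] := HI n n0; rewrite ler_distl => /andP[lo hi].
  have -> : pr0 = n%:R^-1 * (n%:R * pr0) by rewrite mulrA mulVf ?mul1r ?gt_eqF.
  by rewrite -!mulrDr !ler_pM2l ?invr_gt0 // lo hi.
have -> : limn (fun n : nat => (n%:R^-1)%:E *
    \int[Q]_(x in (X : set (MT k))) (ln (phi n x))%:E)%E = (pr0 + u)%:E.
  apply: cvg_lim => //.
  have cI' : (fun n : nat => (n%:R^-1 * I n)%:E) @ \oo --> (pr0 + u)%:E.
    by apply: cvg_EFin; [exact: nearW|exact: cI].
  apply: cvg_trans cI'; apply: near_eq_cvg; near=> n.
  by have [|-> _] := HI n; [near: n; apply: nbhs_infty_gt|rewrite EFinM].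
by rewrite -EFinD; congr EFin; ring.
Unshelve. all: by end_near. Qed.

Lemma same_measure_of_divergence (D : R) :
  (forall n, - D <= Hlaw q n + Hcross q m n) -> same_measure Q P.
Proof.
move=> hD; apply: same_measure_of_word_law => w.
have := law_eq_of_bounded_divergence sq sm gibbs_support c0 mc hD.
by apply.
Qed.

(** Domination of the word laws by the factor D bounds every divergence by ln D, so uniqueness among
    Gibbs measures follows without passing to rates. *)
Lemma same_measure_of_gibbs (D : R) : 1 <= D ->
  (forall x n, (0 < n)%N -> X x -> q (pref n x) <= D * m (pref n x)) ->
  same_measure Q P.
Proof.
move=> D1 hD; have D0 : 0 < D by apply: lt_le_trans D1.
apply: (@same_measure_of_divergence (ln D)) => n.
rewrite /Hlaw /Hcross -big_split /= -[X in X <= _]mul1r -[X in X * _](law_total sq n) mulr_suml.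
apply: ler_sum => w _.
have [->|qw] := eqVneq (q w) 0; first by rewrite !mul0r oppr0 addr0.
have q0 : 0 < q w by rewrite lt_neqAle eq_sym qw (law_ge0 sq).
have m0 : 0 < m w.
  by rewrite lt_neqAle eq_sym (law_ge0 sm) andbT; apply/eqP => /gibbs_support /eqP; apply/negP.
rewrite -mulrN -mulrDr ler_wpM2l ?(ltW q0) //.
rewrite -[X in _ <= X]opprK opprD opprK lerN2 lerBlDr -lnM ?posrE // ler_ln ?posrE ?mulr_gt0 //.
have [x Xx xw] := word_law_support mX QX qw.
(* The domination is only given for nonempty words; for the empty word it is 1 <= D. *)
have [z|n0] := posnP (size w); last by have := hD x _ n0 Xx; rewrite xw.
have -> : (w : seq _) = [::] by apply/size0nil.
by case: sq => -> _ _ _; case: (sm) => -> _ _ _; rewrite mulr1.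
Qed.

End OtherMeasure.

Lemma free_energy_gibbs : free_energy X phi P = pr0%:E.
Proof.
have [s [-> _ _ hs]] := free_energyE Pinv PX.
rewrite hs ?addr0 // => n; rewrite /Hlaw /Hcross -big_split big1 // => w _ /=.
by rewrite addNr.
Qed.

Lemma free_energy_le Q : invariant_measure X Q -> (free_energy X phi Q <= pr0%:E)%E.
Proof.
move=> [QX Qinv]; have [s [-> s0 _ _]] := free_energyE Qinv QX.
by rewrite lee_fin gerDl.
Qed.

Lemma var_sup_gibbs : var_sup X phi = pr0%:E.
Proof.
apply/eqP; rewrite eq_le; apply/andP; split.
  by apply: ge_ereal_sup => _ [Q hQ <-]; exact: free_energy_le.
by rewrite -free_energy_gibbs; apply: ereal_sup_ubound; exists P.
Qed.

Lemma equilibrium_state_gibbs : equilibrium_state X phi P.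
Proof. by rewrite /equilibrium_state free_energy_gibbs var_sup_gibbs. Qed.

Lemma equilibrium_state_unique Q : equilibrium_state X phi Q -> same_measure Q P.
Proof.
move=> [[QX Qinv]]; rewrite var_sup_gibbs.
have [s [-> _ hs _]] := free_energyE Qinv QX => -[s0].
apply: (same_measure_of_divergence Qinv QX (D := ln K)); apply: hs.
by move: s0 => /eqP; rewrite -subr_eq0 addrAC subrr add0r => /eqP.
Qed.

End GibbsState.

(** * From Gibbs bounds to word laws *)

Section GibbsBounds.
Variables (R : realType) (k : nat) (X : set (pts k)) (phi : nat -> pts k -> R).
Variable P : probability (MT k) R.
Local Notation m := (word_law P).
Hypotheses (mX : measurable (X : set (MT k))) (pot : potential X phi).

Lemma gibbs_bounds : gibbs X phi P -> exists pr0 C : R,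
  [/\ pressure X phi = pr0%:E, 1 <= C, forall x n, X x -> 0 < m (pref n x),
    forall x n, (0 < n)%N -> X x -> phi n x <= C * expR (n%:R * pr0) * m (pref n x) &
    forall x n, (0 < n)%N -> X x -> C^-1 * expR (n%:R * pr0) * m (pref n x) <= phi n x].
Proof.
move=> [PX [pr0 hpr [C C0 hC]]].
have bnd x n : (0 < n)%N -> X x ->
    C^-1 * phi n x < expR (n%:R * pr0) * m (pref n x) /\
    expR (n%:R * pr0) * m (pref n x) < C * phi n x.
  move=> n0 Xx; have p0 : 0 < phi n x by exact: (pot n0).1.
  have := hC x n Xx n0; rewrite -/(pr P _) (pr_cyl mX PX).
  have e0 : 0 < expR (- (n%:R * pr0)) by exact: expR_gt0.
  rewrite ltr_pdivlMr ?mulr_gt0 // ltr_pdivrMr ?mulr_gt0 // => -[h1 h2].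
  have e1 := expR_gt0 (n%:R * pr0).
  have ee : expR (n%:R * pr0) * expR (- (n%:R * pr0)) = 1.
    by rewrite expRN mulfV // gt_eqF.
  split.
    have : expR (n%:R * pr0) * (C^-1 * (expR (- (n%:R * pr0)) * phi n x)) <
      expR (n%:R * pr0) * m (pref n x) by rewrite ltr_pM2l.
    rewrite (_ : expR (n%:R * pr0) * (C^-1 * (expR (- (n%:R * pr0)) * phi n x)) =
      C^-1 * phi n x * (expR (n%:R * pr0) * expR (- (n%:R * pr0)))); last by ring.
    by rewrite ee mulr1.
  have : expR (n%:R * pr0) * m (pref n x) <
      expR (n%:R * pr0) * (C * (expR (- (n%:R * pr0)) * phi n x)) by rewrite ltr_pM2l.
  rewrite (_ : expR (n%:R * pr0) * (C * (expR (- (n%:R * pr0)) * phi n x)) =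
    C * phi n x * (expR (n%:R * pr0) * expR (- (n%:R * pr0)))); last by ring.
  by rewrite ee mulr1.
have [x0 Xx0] : exists x, X x.
  apply: contrapT => no; have : P X = P set0.
    by congr (P _); apply/seteqP; split => // x Xx; case: no; exists x.
  by rewrite PX measure0 => /eqP; rewrite onee_eq0.
have C1 : 1 <= C.
  have [a b] := bnd x0 1%N isT Xx0.
  have p0 : 0 < phi 1%N x0 by exact: (pot _).1.
  have : C^-1 < C by rewrite -(ltr_pM2r p0); exact: lt_trans a b.
  move=> h; rewrite leNgt; apply/negP => C1.
  have : 1 < C^-1 by rewrite invf_gt1.
  by lra.
exists pr0, C; split => //.
- move=> x [|n] Xx.
    have -> : pref 0 x = [::] by [].
    rewrite /word_law (_ : [set _ | _] = setT) ?prT //.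
    by apply/seteqP; split.
  have [a _] := bnd x n.+1 isT Xx.
  have p0 : 0 < phi n.+1 x by exact: (pot _).1.
  rewrite -(pmulr_rgt0 _ (expR_gt0 (n.+1%:R * pr0))).
  by apply: lt_trans a; rewrite mulr_gt0 ?invr_gt0.
- move=> x n n0 Xx; have [a _] := bnd x n n0 Xx.
  by rewrite -mulrA -ler_pdivrMl // ltW.
- move=> x n n0 Xx; have [_ b] := bnd x n n0 Xx.
  by rewrite -mulrA ler_pdivrMl // ltW.
Qed.

End GibbsBounds.

(** The inverse of 1 plus the sum of all inverses lies below every positive value; zeros contribute
    0, and I may be empty. *)
Lemma finite_positive_bound (R : realType) (I : finType) (F : I -> R) :
  (forall i, 0 <= F i) -> exists2 e, 0 < e & forall i, F i = 0 \/ e <= F i.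
Proof.
move=> F0; pose s := \sum_i (F i)^-1.
have s0 : 0 <= s by apply: sumr_ge0 => i _; rewrite invr_ge0.
exists (1 + s)^-1; first by rewrite invr_gt0; lra.
move=> i; have [->|nz] := eqVneq (F i) 0; [by left|right].
have Fi : 0 < F i by rewrite lt_neqAle eq_sym nz F0.
rewrite -[X in _ <= X]invrK lef_pV2 ?posrE ?invr_gt0 //; last by lra.
apply: (@le_trans _ _ s); last by rewrite lerDr.
by rewrite /s (bigD1 i) //= lerDl sumr_ge0 // => j _; rewrite invr_ge0.
Qed.

Section AlmostAdditive.
Variables (R : realType) (k : nat) (X : set (pts k)) (f : nat -> pts k -> R).
Variables (P : probability (MT k) R) (pr0 C a : R).
Local Notation m := (word_law P).
Hypothesis Pinv : forall E : set (MT k), measurable E -> P (@mshift k @^-1` E) = P E.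
Hypotheses (shX : forall x, X x -> X (sshift x)) (mX : measurable (X : set (MT k)))
  (PX : P X = 1%E) (C1 : 1 <= C)
  (f_gt0 : forall x n, (0 < n)%N -> X x -> 0 < f n x)
  (m_gt0 : forall x n, X x -> 0 < m (pref n x))
  (f_le : forall x n, (0 < n)%N -> X x ->
     f n x <= C * expR (n%:R * pr0) * m (pref n x))
  (f_ge : forall x n, (0 < n)%N -> X x ->
     C^-1 * expR (n%:R * pr0) * m (pref n x) <= f n x).
Hypotheses (a0 : 0 < a)
  (aaf : forall n m x, (0 < n)%N -> (0 < m)%N -> X x ->
    expR (- a) * f n x * f m (iter n sshift x) <= f (n + m)%N x /\
    f (n + m)%N x <= expR a * f n x * f m (iter n sshift x)).

Let sm := word_law_stationary Pinv.
Let C0 : 0 < C. Proof. by apply: lt_le_trans C1. Qed.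
Let m0 := law_ge0 sm.
Let e0 n : 0 < expR (n%:R * pr0) := expR_gt0 _.
Let eD n1 n2 : expR ((n1 + n2)%:R * pr0) = expR (n1%:R * pr0) * expR (n2%:R * pr0).
Proof. by rewrite natrD mulrDl expRD. Qed.

Lemma iter_sshift_in n x : X x -> X (iter n sshift x).
Proof. by elim: n => //= n IH Xx; apply: shX; exact: IH. Qed.

(** One factor C passes from m (u ++ v) to f, one for each of u and v passes back, and expR a is the
    cost of splitting f. Empty words are treated apart, since almost additivity concerns positive
    lengths. *)
Lemma word_law_quasi_bernoulli u v :
  m (u ++ v) <= (C ^+ 3 * expR a) * m u * m v.
Proof.
have K1 : 1 <= C ^+ 3 * expR a by rewrite mulr_ege1 ?exprn_ege1 // ltW // expR_gt1.
have K0 : 0 < C ^+ 3 * expR a by apply: lt_le_trans K1.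
have m1 : m [::] = 1 by case: sm.
case: u => [|u1 u]; first by rewrite m1 mulr1 /= ler_peMl.
case: v => [|v1 v]; first by rewrite m1 mulr1 cats0 ler_peMl.
set U := u1 :: u; set V := v1 :: v.
have [->|nz] := eqVneq (m (U ++ V)) 0; first by rewrite !mulr_ge0 // ltW.
have [x Xx] := word_law_support mX PX nz; rewrite size_cat prefD => xuv.
have xu : pref (size U) x = U.
  by have := congr1 (take (size U)) xuv; rewrite !take_size_cat ?size_pref.
have xv : pref (size V) (iter (size U) sshift x) = V.
  by have := congr1 (drop (size U)) xuv; rewrite !drop_size_cat ?size_pref.
have Xs := iter_sshift_in (size U) Xx.
have h1 := f_ge (x := x) (n := size U + size V) isT Xx; rewrite prefD xu xv in h1.
have [_ h2] := aaf (x := x) (n := size U) (m := size V) isT isT Xx.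
have h3 := f_le (n := size U) isT Xx; rewrite xu in h3.
have h4 := f_le (n := size V) isT Xs; rewrite xv in h4.
have h5 := le_trans h1 h2.
have h6 : f (size U) x * f (size V) (iter (size U) sshift x) <=
   (C * expR ((size U)%:R * pr0) * m U) * (C * expR ((size V)%:R * pr0) * m V).
  by apply: ler_pM => //; apply/ltW/f_gt0.
have h7 := le_trans h5 (_ : _ <= expR a * ((C * expR ((size U)%:R * pr0) * m U) *
   (C * expR ((size V)%:R * pr0) * m V))).
have {}h7 := h7 (_ : _); rewrite -mulrA ler_wpM2l ?expR_ge0 // in h7.
have {}h7 := h7 isT.
rewrite eD in h7; set E1 := expR _ in h7; set E2 := expR _ in h7.
have E10 : 0 < E1 by exact: e0.
have E20 : 0 < E2 by exact: e0.
rewrite -mulrA ler_pdivrMl // in h7.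
rewrite -(ler_pM2l (mulr_gt0 E10 E20)); apply: (le_trans h7).
by rewrite le_eqVlt; apply/orP; left; apply/eqP; ring.
Qed.

Lemma allowable_of_law u : m u != 0 -> allowable X u.
Proof. by move=> /(word_law_support mX PX)[x Xx xu]; exists x => //; exists 0%N. Qed.

(** Specification provides one gap word w with uwv allowable, and its term alone bounds the sum from
    below: m w is bounded below because there are finitely many words of length p. *)
Lemma word_law_transitive : specification X ->
  exists (p : nat) (c : R), [/\ 0 < c &
    forall u v, c * m u * m v <= \sum_(w : p.-tuple 'I_k.+1) m (u ++ w ++ v)].
Proof.
move=> [p p0 spec]; exists p.
have [e ee he] := finite_positive_bound (fun w : p.-tuple 'I_k.+1 => m0 w).
(* The minimum with 1 makes c <= 1, which the cases of an empty u or v require. In c, the power 4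
   counts one passage between f and m for uwv and one for each of u, w, v; the power 2 counts the
   two splittings. *)
pose e1 := Num.min e 1.
have e10 : 0 < e1 by rewrite lt_min ee /=.
pose c := C^-1 ^+ 4 * expR (- a) ^+ 2 * e1.
have c0 : 0 < c by rewrite !mulr_gt0 ?exprn_gt0 ?invr_gt0 ?expR_gt0.
have c1 : c <= 1.
  have Ci1 : C^-1 <= 1 by rewrite invf_le1.
  have ea1 : expR (- a) <= 1 by rewrite ltW // expR_lt1 oppr_lt0.
  have e11 : e1 <= 1 by rewrite ge_min lexx orbT.
  by rewrite !mulr_ile1 ?exprn_ile1 ?mulr_ge0 ?exprn_ge0 ?invr_ge0 ?expR_ge0 ?(ltW C0) ?(ltW e10).
exists c; split => // u v.
have m1 : m [::] = 1 by case: sm.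
case: u => [|u1 u].
  by rewrite m1 mulr1 (law_prefix sm p v) ler_piMl.
case: v => [|v1 v].
  rewrite m1 mulr1; under eq_bigr => w _ do rewrite cats0.
  by rewrite (law_suffix sm p) ler_piMl.
set U := u1 :: u; set V := v1 :: v.
have S0 : 0 <= \sum_(w : p.-tuple 'I_k.+1) m (U ++ w ++ V) by exact: sumr_ge0.
have [->|nu] := eqVneq (m U) 0; first by rewrite mulr0 mul0r.
have [->|nv] := eqVneq (m V) 0; first by rewrite mulr0.
have [w [sw [z Xz [j uwv]]]] := spec U V (allowable_of_law nu) (allowable_of_law nv).
pose x := iter j sshift z; have Xx : X x by exact: iter_sshift_in.
have {}uwv : pref (size U + (p + size V)) x = U ++ w ++ V.
  rewrite uwv !size_cat sw; apply: eq_map => i.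
  by rewrite /x iter_sshift.
apply: (@le_trans _ _ (m (U ++ w ++ V))); last first.
  have st : size w == p by rewrite sw.
  by rewrite (bigD1 (Tuple st)) //= lerDl sumr_ge0.
rewrite prefD in uwv.
have xu : pref (size U) x = U.
  by have := congr1 (take (size U)) uwv; rewrite !take_size_cat ?size_pref.
have {uwv} xwv : pref (p + size V) (iter (size U) sshift x) = w ++ V.
  by have := congr1 (drop (size U)) uwv; rewrite !drop_size_cat ?size_pref.
rewrite prefD in xwv.
set y := iter (size U) sshift x in xwv; have Xy : X y by exact: iter_sshift_in.
have yw : pref p y = w.
  by have := congr1 (take p) xwv; rewrite !take_size_cat ?size_pref.
have yv : pref (size V) (iter p sshift y) = V.
  by have := congr1 (drop p) xwv; rewrite !drop_size_cat ?size_pref.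
have Xt := iter_sshift_in p Xy.
have h1 := f_le (x := x) (n := size U + (p + size V)) isT Xx.
rewrite prefD xu -/y prefD yw yv in h1.
have pV0 : (0 < p + size V)%N by rewrite addn_gt0 p0.
have [h2 _] := aaf (x := x) (n := size U) (m := p + size V) isT pV0 Xx.
have [h3 _] := aaf (x := y) (n := p) (m := size V) p0 isT Xy.
have h4 := f_ge (n := size U) isT Xx; rewrite xu in h4.
have h5 := f_ge (n := size V) isT Xt; rewrite yv in h5.
have h6 := f_ge p0 Xy; rewrite yw in h6.
have mw : e1 <= m w.
  have st : size w == p by rewrite sw.
  have := he (Tuple st); rewrite /= => -[mw0|].
    by have := m_gt0 p Xy; rewrite yw mw0 ltxx.
  by apply: le_trans; rewrite ge_min lexx.
rewrite -/y in h2.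
set E1 := expR ((size U)%:R * pr0) in h4; set E2 := expR ((size V)%:R * pr0) in h5.
set Ep := expR (p%:R * pr0) in h6.
have E10 : 0 < E1 by exact: e0.
have E20 : 0 < E2 by exact: e0.
have Ep0 : 0 < Ep by exact: e0.
rewrite !eD -/E1 -/E2 -/Ep in h1.
have Ci0 : 0 < C^-1 by rewrite invr_gt0.
have ea0 := expR_gt0 (- a).
have g6 : C^-1 * Ep * e1 <= f p y.
  by apply: le_trans h6; rewrite ler_wpM2l // mulr_ge0 // ltW.
have g3 : expR (- a) * (C^-1 * Ep * e1) * (C^-1 * E2 * m V) <= f (p + size V)%N y.
  apply: le_trans h3; apply: ler_pM => //.
  - by rewrite !mulr_ge0 // ltW.
  - by rewrite !mulr_ge0 // ltW.
  - by rewrite ler_wpM2l // ltW.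
have g2 : expR (- a) * (C^-1 * E1 * m U) *
    (expR (- a) * (C^-1 * Ep * e1) * (C^-1 * E2 * m V)) <= f (size U + (p + size V))%N x.
  apply: le_trans h2; apply: ler_pM => //.
  - by rewrite !mulr_ge0 // ltW.
  - by rewrite !mulr_ge0 // ltW.
  - by rewrite ler_wpM2l // ltW.
have g1 := le_trans g2 h1.
have EE : 0 < C * (E1 * (Ep * E2)) by rewrite !mulr_gt0.
rewrite -(ler_pM2l EE); apply: le_trans g1; rewrite le_eqVlt; apply/orP; left.
by apply/eqP; rewrite /c; field; rewrite gt_eqF.
Qed.

(** Splitting off one letter at a time gives f n >= b ^ n, where b includes the loss expR (- a) of
    one splitting. The single factor C^-1 of the Gibbs bound is at most 1 and can be charged to
    every letter. *)
Lemma word_law_exp_lower : exists2 d : R, 0 < d &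
  forall w, m w = 0 \/ d ^+ size w <= m w.
Proof.
have [e ee he] := finite_positive_bound (fun w : 1.-tuple 'I_k.+1 => m0 w).
pose b := expR (- a) * (C^-1 * expR (1%:R * pr0) * e).
have ea0 := expR_gt0 (- a).
have Ci0 : 0 < C^-1 by rewrite invr_gt0.
have b0 : 0 < b by rewrite !mulr_gt0 ?expR_gt0.
have f1 x : X x -> b <= expR (- a) * f 1 x.
  move=> Xx; rewrite ler_pM2l //.
  apply: le_trans (f_ge (n := 1) isT Xx); rewrite ler_wpM2l //.
    by rewrite mulr_ge0 ?expR_ge0 // ltW.
  have := he (pref_tuple 1 x) => -[z|//].
  by have := m_gt0 1 Xx; rewrite -[pref 1 x]/(val (pref_tuple 1 x)) z ltxx.
have fn n x : X x -> b ^+ n.+1 <= f n.+1 x.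
  elim: n x => [|n IH] x Xx.
    rewrite expr1; apply: le_trans (f1 x Xx) _; rewrite ler_piMl //.
      exact/ltW/f_gt0.
    by rewrite ltW // expR_lt1 oppr_lt0.
  have [h _] := aaf (x := x) (n := 1) (m := n.+1) isT isT Xx.
  apply: le_trans h; rewrite exprS; apply: ler_pM.
  - exact: ltW.
  - by rewrite exprn_ge0 // ltW.
  - exact: f1.
  - by apply: IH; exact: shX.
exists (C^-1 * expR (- pr0) * b); first by rewrite !mulr_gt0 ?expR_gt0.
move=> w; have [->|nz] := eqVneq (m w) 0; [by left|right].
have [x Xx xw] := word_law_support mX PX nz.
case sw : (size w) => [|n].
  by rewrite (size0nil sw) expr0; case: sm => ->.
rewrite sw in xw; have h := f_le (n := n.+1) isT Xx; rewrite xw in h.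
have h2 := le_trans (fn n x Xx) h.
have {}h2 : C^-1 * b ^+ n.+1 <= expR (n.+1%:R * pr0) * m w by rewrite ler_pdivrMl // mulrA.
rewrite exprMn [(C^-1 * _) ^+ _]exprMn -expRM_natl.
apply: (@le_trans _ _ (C^-1 * expR (n.+1%:R * - pr0) * b ^+ n.+1)).
  rewrite -!mulrA ler_wpM2r ?mulr_ge0 ?expR_ge0 ?exprn_ge0 ?(ltW b0) //.
  by rewrite exprS ler_piMr ?(ltW Ci0) // exprn_ile1 ?(ltW Ci0) // invf_le1.
rewrite -(ler_pM2l (e0 n.+1)); apply: le_trans h2.
rewrite mulrN expRN le_eqVlt; apply/orP; left; apply/eqP.
by field; rewrite !gt_eqF // e0.
Qed.

End AlmostAdditive.

(** * The factor potential *)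

Section ImageLaw.
Variables (R : realType) (A B : finType) (p : A -> B) (m : seq A -> R).
Hypothesis sm : stationary_law m.

Definition image_law (v : seq B) : R :=
  \sum_(u : (size v).-tuple A) m u * (map p u == v)%:R.

Let m0 := law_ge0 sm.

Lemma image_lawE n (v : seq B) : size v = n ->
  image_law v = \sum_(u : n.-tuple A) m u * (map p u == v)%:R.
Proof. by move=> <-. Qed.

Lemma image_law_term (u : seq A) : m u <= image_law (map p u).
Proof.
rewrite (@image_lawE (size u)) ?size_map // (bigD1 (in_tuple u)) //= eqxx mulr1.
by rewrite lerDl sumr_ge0 // => w _; rewrite mulr_ge0.
Qed.

Lemma image_law_cat (v1 v2 : seq B) : image_law (v1 ++ v2) =
  \sum_(u1 : (size v1).-tuple A) \sum_(u2 : (size v2).-tuple A)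
    m (u1 ++ u2) * ((map p u1 == v1)%:R * (map p u2 == v2)%:R).
Proof.
rewrite (@image_lawE (size v1 + size v2)) ?size_cat //.
rewrite (big_tuple_cat _ _ (fun u => m u * (map p u == v1 ++ v2)%:R)).
apply: eq_bigr => u1 _; apply: eq_bigr => u2 _.
by rewrite map_cat eqseq_cat ?size_map ?size_tuple // -natrM mulnb.
Qed.

Lemma image_law_quasi_bernoulli (K : R) :
  (forall u v, m (u ++ v) <= K * m u * m v) ->
  forall u v, image_law (u ++ v) <= K * image_law u * image_law v.
Proof.
move=> mK v1 v2; rewrite image_law_cat /image_law -mulrA big_distrlr mulr_sumr /=.
apply: ler_sum => u1 _; rewrite mulr_sumr; apply: ler_sum => u2 _.
have := ler_wpM2r (_ : 0 <= (map p u1 == v1)%:R * (map p u2 == v2)%:R) (mK u1 u2).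
move=> /(_ (mulr_ge0 (ler0n _ _) (ler0n _ _))) /le_trans; apply.
by rewrite le_eqVlt; apply/orP; left; apply/eqP; ring.
Qed.

(** Each gap word over A has exactly one image, so summing over all gap words of B amounts to
    summing over all gap words of A; the bound is then summed over the preimages of u and v. *)
Lemma image_law_transitive (s : nat) (c : R) :
  (forall u v, c * m u * m v <= \sum_(w : s.-tuple A) m (u ++ w ++ v)) ->
  forall u v, c * image_law u * image_law v <=
    \sum_(w : s.-tuple B) image_law (u ++ w ++ v).
Proof.
move=> mc v1 v2.
have -> : \sum_(w : s.-tuple B) image_law (v1 ++ w ++ v2) =
    \sum_(u1 : (size v1).-tuple A) \sum_(u2 : (size v2).-tuple A)
      (\sum_(z : s.-tuple A) m (u1 ++ z ++ u2)) *
        ((map p u1 == v1)%:R * (map p u2 == v2)%:R).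
  transitivity (\sum_(w : s.-tuple B) \sum_(u1 : (size v1).-tuple A)
    \sum_(z : s.-tuple A) \sum_(u2 : (size v2).-tuple A)
     m (u1 ++ z ++ u2) * ((map p u1 == v1)%:R * ((map p z == w)%:R * (map p u2 == v2)%:R))).
    apply: eq_bigr => w _.
    rewrite (@image_lawE (size v1 + (s + size v2))) ?size_cat ?size_tuple //.
    rewrite (big_tuple_cat _ _ (fun u => m u * (map p u == v1 ++ w ++ v2)%:R)).
    apply: eq_bigr => u1 _.
    rewrite (big_tuple_cat _ _ (fun u => m (u1 ++ u) * (map p (u1 ++ u) == v1 ++ w ++ v2)%:R)).
    apply: eq_bigr => z _; apply: eq_bigr => u2 _.
    rewrite !map_cat eqseq_cat ?size_map ?size_tuple // eqseq_cat ?size_map ?size_tuple //.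
    by rewrite -!natrM !mulnb.
  rewrite exchange_big; apply: eq_bigr => u1 _ /=.
  rewrite exchange_big /= [RHS](_ : _ = \sum_(z : s.-tuple A) \sum_(u2 : (size v2).-tuple A)
    m (u1 ++ z ++ u2) * ((map p u1 == v1)%:R * (map p u2 == v2)%:R)); last first.
    by rewrite exchange_big; apply: eq_bigr => u2 _; rewrite mulr_suml.
  apply: eq_bigr => z _; rewrite exchange_big; apply: eq_bigr => u2 _ /=.
  rewrite (bigD1 [tuple of map p z]) //= eqxx mul1r big1 ?addr0 // => w.
  by rewrite -val_eqE /= eq_sym => /negPf ->; rewrite mul0r !mulr0.
rewrite /image_law -mulrA big_distrlr mulr_sumr /=.
apply: ler_sum => u1 _; rewrite mulr_sumr; apply: ler_sum => u2 _.
have := ler_wpM2r (_ : 0 <= (map p u1 == v1)%:R * (map p u2 == v2)%:R) (mc u1 u2).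
move=> /(_ (mulr_ge0 (ler0n _ _) (ler0n _ _))); apply: le_trans.
by rewrite le_eqVlt; apply/orP; left; apply/eqP; ring.
Qed.

Lemma image_law_exp_lower (d : R) : (forall w, m w = 0 \/ d ^+ size w <= m w) ->
  forall v, image_law v = 0 \/ d ^+ size v <= image_law v.
Proof.
move=> md v; have [[u /andP[/eqP uv mu]]|no] :=
    pselect (exists u : (size v).-tuple A, (map p u == v) && (m u != 0)).
  right; have := image_law_term u; rewrite uv; apply: le_trans.
  by have [z|] := md u; [rewrite z eqxx in mu|rewrite size_tuple].
left; apply: big1 => u _; case: eqP => uv; rewrite ?mulr0 // mulr1.
apply/eqP/negPn/negP => mu; apply: no; exists u.
by rewrite uv eqxx.
Qed.

End ImageLaw.

(** * Comparison of g_n with the image measure *)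

Section Factor.
Variables (R : realType) (k l : nat) (X : set (pts k)) (Y : set (pts l)).
Variables (p : 'I_k.+1 -> 'I_l.+1) (f : nat -> pts k -> R).
Variables (mu : probability (MT k) R) (nu : probability (MT l) R) (pr0 C : R).
Hypotheses (YE : Y = factor_map p @` X)
  (nuE : forall E : set (MT l), measurable E -> nu E = mu (factor_map p @^-1` E)).
Hypotheses (mX : measurable (X : set (MT k))) (mY : measurable (Y : set (MT l)))
  (muX : mu X = 1%E).

Lemma preimage_measurable_factor (E : set (MT l)) : measurable E ->
  measurable (factor_map p @^-1` E : set (MT k)).
Proof. by move=> mE; rewrite -[X in measurable X]setTI; exact: measurable_factor_map. Qed.

Lemma factor_invariant : invariant_measure X mu -> invariant_measure Y nu.
Proof.
move=> [_ muinv]; split.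
  rewrite nuE // (prE mu (preimage_measurable_factor mY)); congr EFin.
  apply/eqP; rewrite eq_le -{1}(prT mu) le_pr //=; last exact: preimage_measurable_factor.
  have <- : pr mu X = 1 by rewrite /pr muX.
  apply: le_pr => //; first exact: preimage_measurable_factor.
  by move=> x Xx; rewrite YE; exists x.
move=> E mE; rewrite !nuE //; last first.
  exact: measurable_preimage_tr (@measurable_mshift l) _ mE.
by rewrite -(muinv _ (preimage_measurable_factor mE)).
Qed.

Lemma word_law_factor : word_law nu =1 image_law p (word_law mu).
Proof.
move=> v; rewrite /image_law -(pr_pref mu (size v) (fun u => map p u == v)).
rewrite /word_law /pr nuE; last exact: measurable_cylinder.
congr (fine (mu _)); apply/seteqP; split => x /=; rewrite pref_factor; first by move=> ->.
by move=> /eqP.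
Qed.

Local Notation m := (word_law mu).
Local Notation g := (gpot X Y p f).

(** The cylinder of w is nonempty, so the inclusion of cylinders can be tested on one point and
    becomes an equality of words. *)
Lemma En_indexP n y (w : n.-tuple 'I_k.+1) :
  En_index X Y p y w <-> (exists2 x, X x & pref n x = w) /\ map p w = pref n y.
Proof.
split=> [[[x Xx xw] sub]|[ex pw]]; split => //; first by exists x.
  have [_] : cyl Y (pref n y) (factor_map p x).
    by apply: sub; exists x => //; split => //; rewrite size_tuple.
  by rewrite size_pref pref_factor xw.
move=> _ [x [Xx xw] <-]; split; first by rewrite YE; exists x.
by rewrite size_pref pref_factor -pw -xw size_tuple.
Qed.

(** Dependence on n letters only yields both the continuity of g n and bounded variation with
    constant 1. *)
Lemma gpot_pref n y y' : pref n y = pref n y' -> g n y = g n y'.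
Proof. by move=> yy; rewrite /gpot /En_index yy. Qed.

Hypotheses (C1 : 1 <= C)
  (f_le : forall x n, (0 < n)%N -> X x ->
     f n x <= C * expR (n%:R * pr0) * m (pref n x))
  (f_ge : forall x n, (0 < n)%N -> X x ->
     C^-1 * expR (n%:R * pr0) * m (pref n x) <= f n x).

(** Whatever point is chosen in the cylinder of w, f n there is comparable to expR (n * pr0) * m w,
    and the m w over the index set add up to the nu-measure of the prefix of y. *)
Lemma gpot_bounds n y : (0 < n)%N ->
  g n y <= C * expR (n%:R * pr0) * word_law nu (pref n y) /\
  C^-1 * expR (n%:R * pr0) * word_law nu (pref n y) <= g n y.
Proof.
move=> n0; have m0 := fun w => pr_ge0 mu [set x | pref (size w) x = w].
pose choices := [set c : n.-tuple 'I_k.+1 -> pts k |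
  forall w, En_index X Y p y w -> cyl X w (c w)].
have nuS : word_law nu (pref n y) =
    \sum_(w : n.-tuple 'I_k.+1 | `[< En_index X Y p y w >]) m w.
  rewrite word_law_factor (@image_lawE _ _ _ _ _ n) ?size_pref // [RHS]big_mkcond.
  apply: eq_bigr => w _; case: asboolP => [/En_indexP[_ ->]|nE].
    by rewrite eqxx mulr1.
  case: eqP => pw; rewrite ?mulr0 // mulr1; apply/eqP/negPn/negP.
  move=> /(word_law_support mX muX)[x Xx xw]; apply: nE; apply/En_indexP.
  by split => //; exists x => //; rewrite -{1}(size_tuple w).
have bnd c : choices c ->
    \sum_(w : n.-tuple 'I_k.+1 | `[< En_index X Y p y w >]) f n (c w) <=
      C * expR (n%:R * pr0) * word_law nu (pref n y) /\
    C^-1 * expR (n%:R * pr0) * word_law nu (pref n y) <=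
      \sum_(w : n.-tuple 'I_k.+1 | `[< En_index X Y p y w >]) f n (c w).
  move=> hc; rewrite nuS !mulr_sumr; split; apply: ler_sum => w /asboolP /hc[Xc];
    rewrite size_tuple => cw.
    by have := f_le n0 Xc; rewrite cw.
  by have := f_ge n0 Xc; rewrite cw.
have [c hc] : exists c, choices c.
  have ex (w : n.-tuple 'I_k.+1) : exists x, En_index X Y p y w -> cyl X w x.
    have [[[x Xx xw] _]|no] := pselect (En_index X Y p y w); last by exists (fun=> ord0).
    by exists x => _; split => //; rewrite size_tuple.
  by have /choice[c hc] := ex; exists c.
split.
  apply: ge_sup; first by exists (\sum_(w | `[< En_index X Y p y w >]) f n (c w)), c.
  by move=> _ [c' hc' <-]; exact: (bnd c' hc').1.
apply: le_trans (bnd c hc).2 _; apply: ub_le_sup; last by exists c.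
exists (C * expR (n%:R * pr0) * word_law nu (pref n y)).
by move=> _ [c' hc' <-]; exact: (bnd c' hc').1.
Qed.

Hypothesis (m_gt0 : forall x n, X x -> 0 < m (pref n x))
  (muinv : forall E : set (MT k), measurable E -> mu (@mshift k @^-1` E) = mu E).
Let C0 : 0 < C. Proof. by apply: lt_le_trans C1. Qed.

Lemma word_law_factor_gt0 y n : Y y -> 0 < word_law nu (pref n y).
Proof.
rewrite YE => -[x Xx <-]; rewrite word_law_factor pref_factor.
apply: lt_le_trans (image_law_term _ _ _); first exact: m_gt0 Xx.
exact: word_law_stationary muinv.
Qed.

Lemma gpot_gt0 n y : (0 < n)%N -> Y y -> 0 < g n y.
Proof.
move=> n0 Yy; apply: lt_le_trans (gpot_bounds y n0).2.
by rewrite !mulr_gt0 ?invr_gt0 ?expR_gt0 ?word_law_factor_gt0.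
Qed.

Lemma continuous_on_pref n (h : pts l -> R) :
  (forall y y', pref n y = pref n y' -> h y = h y') -> continuous_on Y h.
Proof.
move=> hh y Yy e e0; exists (2%:R ^- n); first by rewrite invr_gt0 exprn_gt0.
move=> y' Yy' yy'; rewrite (hh y y') ?subrr ?normr0 //.
apply: (@eq_from_nth _ ord0) => [|i]; rewrite !size_pref // => i_n.
rewrite !nth_mkseq //; apply: contrapT => /(dist_ge R) h1.
have := le_lt_trans h1 yy'; rewrite ltNge => /negP; apply.
by rewrite lef_pV2 ?posrE ?exprn_gt0 // ler_eXn2l ?ltr1n // ltnW.
Qed.

Lemma potential_gpot : potential Y g.
Proof.
move=> n n0; split; first by move=> y; exact: gpot_gt0.
by apply: (@continuous_on_pref n) => y y'; exact: gpot_pref.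
Qed.

Lemma bdd_variation_gpot : bdd_variation Y g.
Proof.
exists 1 => n y y' n0 Yy Yy' yy'.
by rewrite (gpot_pref yy') divff // gt_eqF // gpot_gt0.
Qed.

(** A * g is exactly subadditive for a suitable constant A, and ln A / n tends to 0, so one
    comparison sequence serves every e. In A = C^3 * K, one C comes from bounding g (n + s) above
    and two from bounding g n and g s below. *)
Lemma asymp_subadditive_gpot (K : R) : 1 <= K -> (exists y, Y y) ->
  (forall y, Y y -> Y (sshift y)) ->
  (forall u v, word_law nu (u ++ v) <= K * word_law nu u * word_law nu v) ->
  asymp_subadditive Y g.
Proof.
move=> K1 [y0 Yy0] shY nuK; split; first exact: potential_gpot.
move=> e e0; pose A := C ^+ 3 * K.
have K0 : 0 < K by apply: lt_le_trans K1.
have A1 : 1 <= A by rewrite mulr_ege1 // exprn_ege1.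
have A0 : 0 < A by apply: lt_le_trans A1.
exists (fun n y => A * g n y); split.
  split.
    move=> n n0; split; first by move=> y Yy; rewrite mulr_gt0 // gpot_gt0.
    by apply: (@continuous_on_pref n) => y y' /gpot_pref ->.
  move=> n s y n0 s0 Yy; set z := iter n sshift y.
  have Yz : Y z by rewrite /z; elim: (n) => //= j; exact: shY.
  have [_ g1] := gpot_bounds y n0; have [_ g2] := gpot_bounds z s0.
  have ns0 : (0 < n + s)%N by rewrite addn_gt0 n0.
  have [g3 _] := gpot_bounds y ns0.
  have n1 := word_law_factor_gt0 n Yy; have n2 := word_law_factor_gt0 s Yz.
  have h : word_law nu (pref (n + s) y) <= K * word_law nu (pref n y) * word_law nu (pref s z).
    by rewrite prefD; exact: nuK.
  set E1 := expR (n%:R * pr0) in g1; set E2 := expR (s%:R * pr0) in g2.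
  have E3 : expR ((n + s)%:R * pr0) = E1 * E2 by rewrite natrD mulrDl expRD.
  rewrite E3 in g3.
  have E10 : 0 < E1 by exact: expR_gt0.
  have E20 : 0 < E2 by exact: expR_gt0.
  have Ci0 : 0 < C^-1 by rewrite invr_gt0.
  have g12 : C^-1 * E1 * word_law nu (pref n y) * (C^-1 * E2 * word_law nu (pref s z)) <=
      g n y * g s z.
    by apply: ler_pM => //; rewrite !mulr_ge0 // ltW.
  have g4 : g (n + s)%N y <= A * (g n y * g s z).
    apply: (le_trans g3).
    have h1 := ler_wpM2l (ltW (mulr_gt0 C0 (mulr_gt0 E10 E20))) h.
    apply: (le_trans h1); apply: le_trans (ler_wpM2l (ltW A0) g12).
    by rewrite le_eqVlt /A; apply/orP; left; apply/eqP; field; rewrite gt_eqF.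
  have gg : 0 <= A * (g n y * g s z).
    by rewrite mulr_ge0 ?(ltW A0) // mulr_ge0 // ltW // gpot_gt0.
  have h2 := ler_wpM2l (ltW A0) g4.
  by apply: (le_trans h2); rewrite le_eqVlt; apply/orP; left; apply/eqP; ring.
have -> : (fun n : nat => (n%:R^-1)%:E *
    ereal_sup [set (`|ln (g n x) - ln (A * g n x)|)%:E | x in Y])%E =
    (fun n => (n%:R^-1 * ln A)%:E).
  apply/funext => -[|n]; first by rewrite invr0 mul0e mul0r.
  (* The difference of logarithms is constant on Y, which is nonempty, so the supremum is over a
     singleton. *)
  rewrite (_ : [set _ | _ in Y] = [set (ln A)%:E]) ?ereal_sup1 ?EFinM //.
  have hA y : Y y -> `|ln (g n.+1 y) - ln (A * g n.+1 y)| = ln A.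
    move=> Yy; rewrite lnM ?posrE ?gpot_gt0 // opprD addrCA subrr addr0 normrN.
    by rewrite ger0_norm // ln_ge0.
  apply/seteqP; split => [_ [y Yy <-]|_ ->]; first by rewrite /= hA.
  by exists y0 => //; rewrite hA.
have c0 : (fun n : nat => (n%:R^-1 * ln A)%:E) @ \oo --> 0%:E.
  apply: cvg_EFin; first exact: nearW.
  rewrite -[X in _ --> X](mul0r (ln A)); apply: cvgMl.
  apply/gtr0_cvgV0; last exact: cvgr_idn.
  by near=> n; rewrite ltr0n; near: n; apply: nbhs_infty_gt.
rewrite is_cvg_limn_esupE; last exact: cvgP c0.
by rewrite (cvg_lim _ c0) // lee_fin ltW.
Unshelve. all: by end_near. Qed.

End Factor.

Theorem theorem3p1 (R : realType) (k l : nat)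
  (X : set (pts k)) (Y : set (pts l)) (p : 'I_k.+1 -> 'I_l.+1)
  (f : nat -> pts k -> R)
  (mu : probability (MT k) R) (nu : probability (MT l) R) :
  @subshift R _ X -> @subshift R _ Y ->
  Y = factor_map p @` X ->
  specification X ->
  almost_additive X f -> bdd_variation X f ->
  invariant_measure X mu -> gibbs X f mu ->
  (forall E : set (MT l), measurable E ->
     nu E = mu (factor_map p @^-1` E)) ->
  let g := gpot X Y p f in
  asymp_subadditive Y g /\ bdd_variation Y g /\
  (invariant_measure Y nu /\ gibbs Y g nu /\
   forall nu' : probability (MT l) R,
     invariant_measure Y nu' -> gibbs Y g nu' -> same_measure nu' nu) /\
  (equilibrium_state Y g nu /\
   forall nu' : probability (MT l) R,
     equilibrium_state Y g nu' -> same_measure nu' nu) /\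
  mixing nu /\
  pressure X f = var_sup X f /\ var_sup X f = var_sup Y g /\
  var_sup Y g = pressure Y g.
Proof.
move=> shX shY YE spec aaf _ muI gmu nuE g.
have mX := measurable_subshift shX; have mY := measurable_subshift shY.
have [potf [a a0 haa]] := aaf; have [muX muinv] := muI.
have [pr0 [C [hpr C1 m_gt0 f_le f_ge]]] := gibbs_bounds mX potf gmu.
have f_gt0 x n : (0 < n)%N -> X x -> 0 < f n x by move=> n0; exact: (potf n n0).1.
have C0 : 0 < C by apply: lt_le_trans C1.
pose K := C ^+ 3 * expR a.
have K1 : 1 <= K by rewrite mulr_ege1 ?exprn_ege1 // ltW // expR_gt1.
have K0 : 0 < K by apply: lt_le_trans K1.
have mK u v : word_law mu (u ++ v) <= K * word_law mu u * word_law mu v.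
  exact: (word_law_quasi_bernoulli muinv shX.2 mX muX C1 f_gt0 f_le f_ge a0 haa).
have [s [c [c0 mc]]] :=
  word_law_transitive muinv shX.2 mX muX C1 m_gt0 f_le f_ge a0 haa spec.
have [d d0 md] :=
  word_law_exp_lower muinv shX.2 mX muX C1 f_gt0 m_gt0 f_le f_ge a0 haa.
have nuI := factor_invariant YE nuE mX mY muX muI; have [nuY nuinv] := nuI.
have sm := word_law_stationary muinv.
have nuL : word_law nu = image_law p (word_law mu).
  by apply/funext; exact: word_law_factor.
have nK u v : word_law nu (u ++ v) <= K * word_law nu u * word_law nu v.
  by rewrite nuL; exact: image_law_quasi_bernoulli.
have nc u v : c * word_law nu u * word_law nu v <=
    \sum_(w : s.-tuple 'I_l.+1) word_law nu (u ++ w ++ v).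
  by rewrite nuL; exact: image_law_transitive.
have nd w : word_law nu w = 0 \/ d ^+ size w <= word_law nu w.
  by rewrite nuL; exact: image_law_exp_lower.
have potg : potential Y g.
  exact: (potential_gpot YE nuE mX muX C1 f_le f_ge m_gt0 muinv).
have n_gt0 y n : Y y -> 0 < word_law nu (pref n y).
  exact: (word_law_factor_gt0 YE nuE m_gt0 muinv).
have g_bnd y n : (0 < n)%N -> Y y ->
    g n y <= C * expR (n%:R * pr0) * word_law nu (pref n y) /\
    C^-1 * expR (n%:R * pr0) * word_law nu (pref n y) <= g n y.
  by move=> n0 _; exact: (gpot_bounds YE nuE mX muX f_le f_ge y n0).
have g_le y n (n0 : (0 < n)%N) (Yy : Y y) := (g_bnd y n n0 Yy).1.
have g_ge y n (n0 : (0 < n)%N) (Yy : Y y) := (g_bnd y n n0 Yy).2.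
have prY : pressure Y g = pr0%:E by exact: (pressureE nuinv mY nuY C0 g_le g_ge).
have vsX : var_sup X f = pr0%:E.
  exact: (var_sup_gibbs muinv mX muX C1 potf m_gt0 f_le f_ge K1 mK d0 md).
have vsY : var_sup Y g = pr0%:E.
  exact: (var_sup_gibbs nuinv mY nuY C1 potg n_gt0 g_le g_ge K1 nK d0 nd).
have [y0 Yy0] : exists y, Y y.
  have nz : word_law nu [::] != 0.
    by case: (word_law_stationary nuinv) => -> _ _ _; exact: oner_neq0.
  by have [y Yy _] := word_law_support mY nuY nz; exists y.
split.
  exact: (asymp_subadditive_gpot YE nuE mX muX C1 f_le f_ge m_gt0 muinv K1
    (ex_intro _ y0 Yy0) shY.2 nK).
split; first exact: (bdd_variation_gpot YE nuE mX muX C1 f_le f_ge m_gt0 muinv).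
split.
  split=> //; split.
    (* The Gibbs inequalities are strict whereas the bounds on g are not, so the constant is
       enlarged. *)
    split=> //; exists pr0 => //; exists (C + 1); first by lra.
    move=> y n Yy n0; rewrite -/(pr nu _) (pr_cyl mY nuY).
    have g0 : 0 < g n y by exact: (potg n n0).1.
    have E0 := expR_gt0 (n%:R * pr0); have E1 := expR_gt0 (- (n%:R * pr0)).
    have EE : expR (- (n%:R * pr0)) * expR (n%:R * pr0) = 1.
      by rewrite expRN mulVf // gt_eqF.
    have n0' := n_gt0 y n Yy.
    have lo := g_le y n n0 Yy; have hi := g_ge y n n0 Yy.
    have {}lo : expR (- (n%:R * pr0)) * g n y <= C * word_law nu (pref n y).
      apply: le_trans (ler_wpM2l (ltW E1) lo) _.
      rewrite (_ : _ * (_ * _ * _) = C * word_law nu (pref n y) *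
        (expR (- (n%:R * pr0)) * expR (n%:R * pr0))); last by ring.
      by rewrite EE mulr1.
    have {}hi : word_law nu (pref n y) <= C * (expR (- (n%:R * pr0)) * g n y).
      have := ler_wpM2l (ltW (mulr_gt0 C0 E1)) hi.
      rewrite (_ : _ * (_ * _ * _) = word_law nu (pref n y) *
        (expR (- (n%:R * pr0)) * expR (n%:R * pr0)) * (C * C^-1)); last by ring.
      by rewrite EE mulfV ?gt_eqF // !mulr1 mulrA.
    have q0 : 0 < expR (- (n%:R * pr0)) * g n y by rewrite mulr_gt0.
    rewrite ltr_pdivlMr // ltr_pdivrMr //; split; last by lra.
    rewrite ltr_pdivrMl; last by lra.
    by apply: le_lt_trans lo _; rewrite ltr_pM2r //; lra.
  move=> nu' [nuY' nuinv'] gnu'.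
  have [pr1 [C' [hpr' C1' _ _ g_ge']]] := gibbs_bounds mY potg gnu'.
  have E : pr1 = pr0 by move: hpr'; rewrite prY => -[].
  have C0' : 0 < C' by apply: lt_le_trans C1'.
  (* Both measures are compared with expR (- (n * pr0)) * g n, with the same exponent because it is
     the pressure; C' bounds nu' by this quantity and C bounds this quantity by nu. *)
  apply: (same_measure_of_gibbs nuinv mY n_gt0 c0 nc nuinv' nuY' (D := C' * C)).
    by rewrite mulr_ege1.
  move=> y n n0 Yy; have h1 := g_ge' y n n0 Yy; rewrite E in h1.
  have := le_trans h1 (g_le y n n0 Yy).
  have E0 := expR_gt0 (n%:R * pr0).
  rewrite -mulrA ler_pdivrMl // => h2.
  rewrite -(ler_pM2l E0); apply: (le_trans h2).
  by rewrite le_eqVlt; apply/orP; left; apply/eqP; ring.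
split.
  split.
    exact: (equilibrium_state_gibbs nuinv mY nuY C1 potg n_gt0 g_le g_ge K1 nK d0 nd).
  move=> nu'.
  exact: (equilibrium_state_unique nuinv mY nuY C1 potg n_gt0 g_le g_ge K1 nK c0 nc d0 nd).
split; first exact: (mixing_of_quasi_bernoulli nuinv K0 nK c0 nc).
by rewrite hpr vsX vsY prY.
Qed.
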